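(* Let $\mathbb{F}_q$ be a fixed finite field with $q$ elements and let $\emptyset \subsetneq \mathcal{A} \subsetneq \mathbb{F}_q$ be a fixed non-empty proper subset. Let $m,n \to \infty$ and let $r$ be positive integers (depending on $m,n$, i.e. consider any sequence of triples $(m,n,r)$ of positive integers with $r\le \min\{m,n\}$ along which $m\to\infty$ and $n \to \infty$) such that $\min\{m,n\}-r \to \infty$ and one of the following three conditions holds: (i) $\lim \frac{q^r}{\min\{m,n\}} = 0$; (ii) $\lim \frac{q^r}{(m+n)^a} = \infty$ for every fixed $a>0$; (iii) $m \asymp n$ and $\lim \frac{q^r}{m} = \infty$. For each such $(m,n,r)$ let $\mathbf{M}$ be a random matrix uniformly distributed in the set $\mathbb{F}_q^{m\times n,r}$ of $m \times n$ matrices of rank $r$ over $\mathbb{F}_q$. Then $$\frac{\mathrm{ct}_{\mathcal{A}}(\mathbf{M})-\mu_{\mathcal{A}}(q,m,n,r)}{\sqrt{\sigma_{\mathcal{A}}^2(q,m,n,r)}}$$ converges in distribution to a standard normal random variable.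
   Context: For a matrix $\mathbf{N}$ over $\mathbb{F}_q$, $\mathrm{ct}_{\mathcal{A}}(\mathbf{N})$ denotes the number of entries of $\mathbf{N}$ that belong to $\mathcal{A}$. Let $\mathbb{1}_{\mathcal{A}}$ be the indicator function of $\mathcal{A}$ on $\mathbb{F}_q$, let $\#\mathcal{A}$ be the cardinality of $\mathcal{A}$, and put $$\gamma_{\mathcal{A}}(q) := q^{-1}\#\mathcal{A} - \mathbb{1}_{\mathcal{A}}(0).$$ For positive integers $m,n,r$, $$\mu_{\mathcal{A}}(q,m,n,r) := mn\left(q^{-1}\#\mathcal{A} - q^{-r}\gamma_{\mathcal{A}}(q)\right),$$ $$\sigma_{\mathcal{A}}^2(q,m,n,r) := mn\left(q^{-1}\#\mathcal{A}-q^{-r}\gamma_{\mathcal{A}}(q)\right)\left(1-q^{-1}\#\mathcal{A}+q^{-r}\gamma_{\mathcal{A}}(q)\right) + mn(m+n-2)q^{-r}(1-q^{-r})\gamma_{\mathcal{A}}(q)^2.$$ The notation $m\asymp n$ means that there are constants $0<c\le C$ with $cn \le m \le Cn$ along the sequence considered. *)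

(* Defs.v *)
From HB Require Import structures.
From mathcomp Require Import all_boot all_order all_algebra.
From mathcomp Require Import all_classical all_reals all_analysis.

Set Implicit Arguments.
Unset Strict Implicit.
Unset Printing Implicit Defensive.

Import Order.TTheory GRing.Theory Num.Theory.
Import numFieldNormedType.Exports.

Local Open Scope classical_set_scope.
Local Open Scope ring_scope.

Section Moments.
Context (R : realType) (F : finFieldType).
Implicit Types (A : {set F}) (m n r : nat).

(* Throughout, q is #|F|. *)
Definition gamma A : R := #|F|%:R^-1 * #|A|%:R - (0 \in A)%:R.

Definition mu A m n r : R :=
  (m * n)%:R * (#|F|%:R^-1 * #|A|%:R - #|F|%:R ^- r * gamma A).

(* The factor m + n - 2 is a real difference, not a truncated one. *)
Definition sigma2 A m n r : R :=
  (m * n)%:R * (#|F|%:R^-1 * #|A|%:R - #|F|%:R ^- r * gamma A)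
    * (1 - #|F|%:R^-1 * #|A|%:R + #|F|%:R ^- r * gamma A)
  + (m * n)%:R * (m%:R + n%:R - 2) * #|F|%:R ^- r * (1 - #|F|%:R ^- r)
    * gamma A ^+ 2.

End Moments.

(* Matrices over a finite field, with the discrete sigma-algebra. *)
Definition dmatrix (F : finFieldType) (m n : nat) : Type := 'M[F]_(m, n).

Section DiscreteMatrix.
Context (F : finFieldType) (m n : nat).

HB.instance Definition _ := Finite.on (dmatrix F m n).
HB.instance Definition _ := isPointed.Build (dmatrix F m n) (0 : 'M[F]_(m, n)).
HB.instance Definition _ := @isMeasurable.Build default_measure_display
  (dmatrix F m n) discrete_measurable discrete_measurable0
  discrete_measurableC discrete_measurableU.

Definition ct (A : {set F}) (N : dmatrix F m n) : nat :=
  #|[set ij : 'I_m * 'I_n | (N : 'M[F]_(m, n)) ij.1 ij.2 \in A]%SET|.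

Definition rank_matrices (r : nat) : {set dmatrix F m n} :=
  [set N : dmatrix F m n | \rank (N : 'M[F]_(m, n)) == r]%SET.

Definition std_ct (R : realType) (A : {set F}) (r : nat)
    (N : dmatrix F m n) : R :=
  ((ct A N)%:R - mu R A m n r) / Num.sqrt (sigma2 R A m n r).

Lemma measurable_std_ct (R : realType) (A : {set F}) (r : nat) :
  measurable_fun [set: dmatrix F m n] (std_ct R A r).
Proof. by []. Qed.

HB.instance Definition _ (R : realType) (A : {set F}) (r : nat) :=
  isMeasurableFun.Build _ _ _ _ (std_ct R A r) (@measurable_std_ct R A r).

Definition uniform_on (R : realType) d (T : measurableType d)
    (P : probability T R) (S : {set dmatrix F m n})
    (M : {RV P >-> dmatrix F m n}) : Prop :=
  forall N : dmatrix F m n,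
    distribution P M [set N] = ((N \in S)%:R / #|S|%:R)%:E.

End DiscreteMatrix.

(* Convergence in distribution of real random variables, possibly defined on
   different probability spaces, to the law nu: pointwise convergence of the
   cdfs at every continuity point of the limit cdf. *)
Definition cvg_in_distribution (R : realType) (d : nat -> measure_display)
    (T : forall k, measurableType (d k)) (P : forall k, probability (T k) R)
    (X : forall k, {RV P k >-> R})
    (nu : probability (measurableTypeR R) R) : Prop :=
  forall x : R, {for x, continuous (fun y : R => nu `]-oo, y]%classic)} ->
    cdf (X k) x @[k --> \oo] --> nu `]-oo, x]%classic.

Definition asymp (R : realType) (m n : nat -> nat) : Prop :=
  exists c C : R, [/\ 0 < c, c <= C &
    forall k, c * (n k)%:R <= (m k)%:R <= C * (n k)%:R].

(* Main.v *)
(* A uniform matrix of rank r is X^T Y conditioned on having rank r, where the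
   columns x_i of X and y_j of Y are independent and uniform in F_q^r; as
   min(m, n) - r grows, that conditioning becomes negligible. The centred count
   of X^T Y has the Hoeffding decomposition
     sum_ij g(x_i, y_j) - gamma n sum_i ([x_i = 0] - q^-r)
                        - gamma m sum_j ([y_j = 0] - q^-r)
   with a kernel g that is degenerate in both arguments. If q^r << min(m, n),
   the two linear sums dominate. If q^r >> m + n, they are negligible, and given
   X the remaining sum is a sum over j of independent identically distributed
   terms whose conditional variance concentrates, because distinct x_i, x_i' are
   almost always linearly independent and then g(x_i, y), g(x_i', y) are almost
   uncorrelated. In both regimes the dominant part is handled by Stein's method:
   it suffices to show that E[f'(W) - W f(W)] tends to 0 uniformly over f with
   bounded Lipschitz f and f'. *)
Require Import Defs.
From HB Require Import structures.
From mathcomp Require Import all_boot all_order all_algebra.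
From mathcomp Require Import all_classical all_reals all_analysis.
From mathcomp Require Import ring lra.

Set Implicit Arguments.
Unset Strict Implicit.
Unset Printing Implicit Defensive.

Import Order.TTheory GRing.Theory Num.Theory.
Import numFieldNormedType.Exports.

Local Open Scope classical_set_scope.
Local Open Scope ring_scope.


(** * Averages over finite types and resampling *)

(** The estimates use only uniform averages over finite types, where independence is a change of
    variables. Two obstacles shape them. The dominant and the negligible part of the count are built
    from the same vectors, hence dependent; the negligible part therefore enters as a perturbation
    small in mean square, which needs no independence. And the test functions must have Stein
    solutions with explicit bounds: a ramp composed with the normal cdf is chosen, because its
    Gaussian integral is elementary and the solution becomes a closed formula. One parameter [eta]
    balances second against fourth moments, so absolute third moments never occur. That [A] is
    non-empty and proper keeps the dominant variance from degenerating: it gives [p * (1 - p) > 0],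
    with [p = #|A| / q], for large [q ^ r], and [gamma != 0] for small [q ^ r]. *)

Definition avg (R : realFieldType) (T : finType) (g : T -> R) : R :=
  (\sum_t g t) / #|T|%:R.

Section Average.
Context (R : realFieldType).
Implicit Types (T : finType).

Lemma eq_avg T (g h : T -> R) : g =1 h -> avg g = avg h.
Proof. by move=> gh; rewrite /avg (eq_bigr h). Qed.

Lemma avg_cst T (c : R) : (0 < #|T|)%N -> avg (fun _ : T => c) = c.
Proof.
by move=> T0; rewrite /avg sumr_const -[c *+ _]mulr_natr mulfK// pnatr_eq0 -lt0n.
Qed.

Lemma avgD T (g h : T -> R) : avg (fun t => g t + h t) = avg g + avg h.
Proof. by rewrite /avg big_split mulrDl. Qed.

Lemma avgB T (g h : T -> R) : avg (fun t => g t - h t) = avg g - avg h.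
Proof. by rewrite /avg sumrB mulrBl. Qed.

Lemma avgZ T (c : R) (g : T -> R) : avg (fun t => c * g t) = c * avg g.
Proof. by rewrite /avg -mulr_sumr mulrA. Qed.

Lemma avgZr T (c : R) (g : T -> R) : avg (fun t => g t * c) = avg g * c.
Proof. by rewrite /avg -mulr_suml mulrAC. Qed.

Lemma avg_sum T (I : finType) (P : pred I) (g : I -> T -> R) :
  avg (fun t => \sum_(i | P i) g i t) = \sum_(i | P i) avg (g i).
Proof. by rewrite /avg exchange_big mulr_suml. Qed.

Lemma ler_avg T (g h : T -> R) : (forall t, g t <= h t) -> avg g <= avg h.
Proof.
by move=> gh; rewrite /avg ler_wpM2r ?invr_ge0 ?ler0n// ler_sum.
Qed.

Lemma avg_ge0 T (g : T -> R) : (forall t, 0 <= g t) -> 0 <= avg g.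
Proof. by move=> g0; rewrite /avg mulr_ge0 ?invr_ge0 ?ler0n// sumr_ge0. Qed.

Lemma ler_norm_avg T (g : T -> R) : `|avg g| <= avg (fun t => `|g t|).
Proof.
rewrite /avg normrM [`|_^-1|]ger0_norm ?invr_ge0 ?ler0n//.
by rewrite ler_wpM2r ?invr_ge0 ?ler0n// ler_norm_sum.
Qed.

Lemma exchange_avg T1 T2 (g : T1 -> T2 -> R) :
  avg (fun s => avg (g s)) = avg (fun t => avg (g^~ t)).
Proof. by rewrite /avg -!mulr_suml exchange_big mulrAC. Qed.

(** The condition [0 <= c] covers the empty type, whose average is the default value 0. *)
Lemma avg_le_cst T (g : T -> R) (c : R) :
  0 <= c -> (forall t, g t <= c) -> avg g <= c.
Proof.
move=> c0 gc; have [T0|T0] := posnP #|T|; last first.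
  by rewrite -[leRHS](@avg_cst T)//; exact: ler_avg.
by rewrite /avg T0 invr0 mulr0.
Qed.

Lemma sqr_avg_le T (g : T -> R) : (avg g) ^+ 2 <= avg (fun t => g t ^+ 2).
Proof.
have [T0|T0] := posnP #|T|; first by rewrite /avg T0 invr0 !mulr0 expr0n.
have : 0 <= avg (fun t => (g t - avg g) ^+ 2) by apply: avg_ge0 => t; rewrite sqr_ge0.
rewrite (eq_avg (h := fun t => g t ^+ 2 + ((- 2 * avg g) * g t + avg g ^+ 2)));
  last by move=> t; ring.
rewrite avgD avgD avgZ avg_cst//; nra.
Qed.

Lemma avg_bij T1 T2 (phi : T1 -> T2) (g : T2 -> R) :
  bijective phi -> avg (g \o phi) = avg g.
Proof.
move=> bphi; rewrite /avg (bij_eq_card bphi); congr (_ / _).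
by rewrite [RHS](reindex phi)//=; exact: onW_bij.
Qed.

End Average.

Section Resampling.
Context (R : realFieldType) (I T : finType).
Hypothesis T_gt0 : (0 < #|T|)%N.

Definition upd (w : {ffun I -> T}) (j : I) (t : T) : {ffun I -> T} :=
  [ffun i => if i == j then t else w i].

Lemma card_ffun_gt0 : (0 < #|{ffun I -> T}|)%N.
Proof. by rewrite card_ffun expn_gt0 T_gt0. Qed.

(** Exchanging the [j]-th coordinate of [w] with the fresh [t] is an involution of the pairs
    [(w, t)], so it preserves the uniform law. This is the form in which independence of coordinates
    is used. *)
Lemma avg_resample (j : I) (Phi : {ffun I -> T} -> R) :
  avg Phi = avg (fun w : {ffun I -> T} => avg (fun t => Phi (upd w j t))).
Proof.
rewrite /avg -[in RHS]mulr_suml; congr (_ / _).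
apply: (mulIf (x := #|T|%:R)); first by rewrite pnatr_eq0 -lt0n.
rewrite mulfVK ?pnatr_eq0 -?lt0n//.
rewrite mulr_natr.
transitivity (\sum_(w : {ffun I -> T}) \sum_(t : T) Phi w).
  by under [RHS]eq_bigr do rewrite sumr_const; rewrite sumrMnl.
rewrite !pair_bigA /=.
pose s (p : {ffun I -> T} * T) := (upd p.1 j p.2, p.1 j).
have sK : involutive s.
  move=> [w t]; rewrite /s /=; congr (_, _); last by rewrite ffunE eqxx.
  by apply/ffunP => i; rewrite !ffunE; case: eqP => // ->.
by rewrite [LHS](reindex s)//; exact/onW_bij/inv_bij.
Qed.

Definition sum_but (xi : T -> R) (j : I) (w : {ffun I -> T}) : R :=
  \sum_(i | i != j) xi (w i).

Lemma sum_butE (xi : T -> R) j (w : {ffun I -> T}) :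
  \sum_i xi (w i) = sum_but xi j w + xi (w j).
Proof. by rewrite (bigD1 j)//= addrC. Qed.

Lemma sum_but_upd xi j w t : sum_but xi j (upd w j t) = sum_but xi j w.
Proof. by apply: eq_bigr => i /negPf ij; rewrite ffunE ij. Qed.

Lemma avg_indep (xi : T -> R) (j : I) (Psi : T -> R -> R) :
  avg (fun w : {ffun I -> T} => Psi (w j) (sum_but xi j w)) =
  avg (fun w : {ffun I -> T} => avg (fun t => Psi t (sum_but xi j w))).
Proof.
rewrite (avg_resample j); apply: eq_avg => w; apply: eq_avg => t.
by rewrite sum_but_upd ffunE eqxx.
Qed.

Lemma avg_sum_split (xi : T -> R) (j : I) (Psi : T -> R -> R) :
  avg (fun w : {ffun I -> T} => Psi (w j) (\sum_i xi (w i))) =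
  avg (fun w : {ffun I -> T} =>
    avg (fun t => Psi t (sum_but xi j w + xi t))).
Proof.
rewrite -(avg_indep xi j (fun t s => Psi t (s + xi t))).
by apply: eq_avg => w; rewrite (sum_butE _ j).
Qed.

Lemma avg_coord (j : I) (g : T -> R) :
  avg (fun w : {ffun I -> T} => g (w j)) = avg g.
Proof.
rewrite (avg_resample j) -[RHS](avg_cst (T := {ffun I -> T})) ?card_ffun_gt0//.
by apply: eq_avg => w; apply: eq_avg => t; rewrite ffunE eqxx.
Qed.

Context (xi : T -> R).
Hypothesis xi0 : avg xi = 0.
Let S (w : {ffun I -> T}) := \sum_i xi (w i).

Lemma avg_sum_sqr : avg (fun w : {ffun I -> T} => S w ^+ 2) = #|I|%:R * avg (fun t => xi t ^+ 2).
Proof.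
transitivity (\sum_(j : I) avg (fun w : {ffun I -> T} => xi (w j) * S w)).
  by rewrite -avg_sum; apply: eq_avg => w; rewrite -mulr_suml expr2.
rewrite mulr_natl -sumr_const; apply: eq_bigr => j _.
etransitivity; first exact: (avg_sum_split xi j (fun t s => xi t * s)).
rewrite /= -[RHS](avg_cst (T := {ffun I -> T})) ?card_ffun_gt0//.
apply: eq_avg => w; rewrite (eq_avg (h := fun t => xi t * sum_but xi j w + xi t ^+ 2));
  last by move=> t; ring.
by rewrite avgD avgZr xi0 mul0r add0r.
Qed.

Lemma avg_sum_but_sqr_le j :
  avg (fun w : {ffun I -> T} => sum_but xi j w ^+ 2) <= #|I|%:R * avg (fun t => xi t ^+ 2).
Proof.
rewrite -avg_sum_sqr.
have -> : avg (fun w => S w ^+ 2) = _ := avg_sum_split xi j (fun _ s => s ^+ 2).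
rewrite /=; apply: ler_avg => w.
rewrite (eq_avg (h := fun t => sum_but xi j w ^+ 2 +
   (xi t * (2 * sum_but xi j w) + xi t ^+ 2))); last by move=> t; ring.
rewrite avgD avg_cst// avgD avgZr xi0 mul0r add0r lerDl.
by apply: avg_ge0 => t; rewrite sqr_ge0.
Qed.

(** Write [S ^ 4] as the sum over [j] of [xi (w j) * S ^ 3] and expand around the sum without [j]:
    the terms odd in that sum vanish because [xi] is centred. Each [j] contributes at most
    [(3 * #|I| + 1) * C ^ 4]. *)
Lemma avg_sum_pow4 (C : R) : (forall t, `|xi t| <= C) ->
  avg (fun w : {ffun I -> T} => S w ^+ 4) <= 4 * #|I|%:R ^+ 2 * C ^+ 4.
Proof.
move=> xiC; have [t0 _] : exists t, t \in T by exact/card_gt0P.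
have C0 : 0 <= C by rewrite (le_trans _ (xiC t0)).
have sqC t : xi t ^+ 2 <= C ^+ 2.
  by rewrite -real_normK ?num_real// lerXn2r ?nnegrE.
set v := avg (fun t => xi t ^+ 2).
have vC : v <= C ^+ 2 by apply: avg_le_cst => //; rewrite sqr_ge0.
have v0 : 0 <= v by apply: avg_ge0 => t; rewrite sqr_ge0.
have kC : avg (fun t => xi t ^+ 4) <= C ^+ 4.
  apply: avg_le_cst => [|t]; first by rewrite exprn_ge0.
  by rewrite !(exprM _ 2 2) ler_sqr ?nnegrE ?sqr_ge0.
have -> : avg (fun w => S w ^+ 4) =
    \sum_(j : I) avg (fun w : {ffun I -> T} => xi (w j) * S w ^+ 3).
  by rewrite -avg_sum; apply: eq_avg => w; rewrite -mulr_suml exprS.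
apply: (@le_trans _ _ (\sum_(j : I) (3 * #|I|%:R * C ^+ 4 + C ^+ 4))); last first.
  rewrite sumr_const -[leLHS]mulr_natl; have [->|I0] := posnP #|I|.
    by rewrite mul0r expr0n mulr0 mul0r.
  have : 1 <= #|I|%:R :> R by rewrite ler1n.
  have : 0 <= C ^+ 4 by rewrite exprn_ge0.
  set a := C ^+ 4; set b : R := #|I|%:R => a0 b1.
  have : 0 <= a * (b * (b - 1)).
    by rewrite mulr_ge0 ?mulr_ge0 ?subr_ge0// (le_trans ler01).
  nra.
apply: ler_sum => j _.
have -> : avg (fun w : {ffun I -> T} => xi (w j) * S w ^+ 3) = _ :=
  avg_sum_split xi j (fun t s => xi t * s ^+ 3).
rewrite /=.
rewrite (eq_avg (h := fun w : {ffun I -> T} => 3 * v * sum_but xi j w ^+ 2 +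
   (sum_but xi j w * (3 * avg (fun t => xi t ^+ 3)) + avg (fun t => xi t ^+ 4)))); last first.
  move=> w; set s := sum_but xi j w.
  rewrite (eq_avg (h := fun t => xi t * s ^+ 3 + (xi t ^+ 2 * (3 * s ^+ 2) +
     (xi t ^+ 3 * (3 * s) + xi t ^+ 4)))); last by move=> t; ring.
  rewrite !avgD !avgZr xi0 -/v; ring.
rewrite avgD avgZ avgD avgZr avg_cst ?card_ffun_gt0//.
have -> : avg (sum_but xi j) = 0.
  rewrite /sum_but avg_sum big1// => i _.
  by rewrite avg_coord.
rewrite mul0r add0r lerD//. rewrite -[leLHS]mulrA -[leRHS]mulrA ler_wpM2l//.
apply: (@le_trans _ _ (v * (#|I|%:R * v))).
  by rewrite ler_wpM2l// avg_sum_but_sqr_le.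
rewrite mulrCA ler_wpM2l ?ler0n// [leRHS](exprM _ 2 2) expr2.
by rewrite ler_pM.
Qed.

End Resampling.

(** The last clause makes [f'] the derivative of [f]; phrased by inequalities, the class makes sense
    over any real field. A single [K] bounds everything, so that all later errors are multiples of
    [K]. *)
Definition stein_class (R : realFieldType) (K : R) (f f' : R -> R) : Prop :=
  [/\ forall x, `|f x| <= K, forall x, `|f' x| <= K,
      forall x y, `|f x - f y| <= K * `|x - y|,
      forall x y, `|f' x - f' y| <= K * `|x - y|
    & forall u x, `|f (u + x) - f u - x * f' u| <= K * x ^+ 2].

(** * Stein estimates for sums of independent terms and for perturbations *)

Section SteinBounds.
Context (R : realFieldType) (K : R) (f f' : R -> R).
Hypothesis ff' : stein_class K f f'.

Lemma stein_class_ge0 : 0 <= K.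
Proof. by case: ff' => fK _ _ _ _; rewrite (le_trans _ (fK 0)). Qed.

Lemma normM_le_amgm (eta x y : R) : 0 < eta ->
  `|x * y| <= (eta * x ^+ 2 + y ^+ 2 / eta) / 2.
Proof.
move=> eta0.
have : 0 <= eta^-1 * (eta * `|x| - `|y|) ^+ 2.
  by rewrite mulr_ge0 ?sqr_ge0// invr_ge0 ltW.
have -> : eta^-1 * (eta * `|x| - `|y|) ^+ 2 =
  eta * `|x| ^+ 2 + `|y| ^+ 2 / eta - 2 * (`|x| * `|y|).
  by field; exact: lt0r_neq0.
rewrite !real_normK ?num_real// normrM; lra.
Qed.

(** Since [xi] has mean 0, [f u] can be subtracted for free, and the first-order Taylor term gives
    the variance times [f' u]; the Lipschitz bound then moves [f' u] to [f' (u + xi)]. Both errors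
    are cubic in [xi], and AM-GM with weight [eta] splits them into second and fourth moments. *)
Lemma stein_step (T : finType) (xi : T -> R) (u eta : R) :
  (0 < #|T|)%N -> avg xi = 0 -> 0 < eta ->
  `|avg (fun t => xi t * f (u + xi t)) -
    avg (fun t => xi t ^+ 2) * avg (fun t => f' (u + xi t))| <=
  K * (eta * avg (fun t => xi t ^+ 2) + avg (fun t => xi t ^+ 4) / eta).
Proof.
move=> T0 xi0 eta0; case: (ff') => _ f'K _ f'lip ftay.
have K0 := stein_class_ge0.
set v := avg (fun t => xi t ^+ 2); set k := avg (fun t => xi t ^+ 4).
have v0 : 0 <= v by apply: avg_ge0 => t; rewrite sqr_ge0.
have -> : avg (fun t => xi t * f (u + xi t)) - v * avg (fun t => f' (u + xi t)) =
   avg (fun t => xi t * (f (u + xi t) - f u - xi t * f' u)) +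
   v * avg (fun t => f' u - f' (u + xi t)).
  rewrite (eq_avg (g := fun t => xi t * (f (u + xi t) - f u - xi t * f' u))
    (h := fun t => xi t * f (u + xi t) - (xi t * f u + xi t ^+ 2 * f' u)));
    last by move=> t; ring.
  by rewrite !avgB avgD !avgZr xi0 avg_cst// -/v; ring.
rewrite [leRHS]splitr.
rewrite (le_trans (ler_normD _ _))// lerD//.
  rewrite (le_trans (ler_norm_avg _))//.
  apply: (@le_trans _ _ (avg (fun t => K / 2 * (eta * xi t ^+ 2 + xi t ^+ 4 * eta^-1)))).
    apply: ler_avg => t; rewrite normrM.
    have := ftay u (xi t); have := normM_le_amgm (xi t) (xi t ^+ 2) eta0.
    rewrite -exprM normrM [`|_ ^+ 2|]ger0_norm ?sqr_ge0//.
    have := normr_ge0 (xi t).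
    set a := `|xi t|; set b := `|f _ - _ - _|; set e := (X in _ <= X / 2).
    move=> a0 h1 h2; apply: (@le_trans _ _ (a * (K * xi t ^+ 2))); first exact: ler_wpM2l.
    rewrite mulrCA -mulrA (mulrC 2^-1); exact: ler_wpM2l.
  by rewrite avgZ avgD avgZ avgZr -/v -/k mulrAC.
rewrite normrM [`|v|]ger0_norm//.
have vk : v ^+ 2 <= k.
  rewrite /v /k (le_trans (sqr_avg_le _))// le_eqVlt; apply/orP; left; apply/eqP.
  by apply: eq_avg => t; rewrite -exprM.
apply: (@le_trans _ _ (v * (K * ((eta + v / eta) / 2)))).
  rewrite ler_wpM2l// (le_trans (ler_norm_avg _))//.
  apply: (@le_trans _ _ (avg (fun t => K * ((eta + xi t ^+ 2 / eta) / 2)))).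
    apply: ler_avg => t; apply: le_trans (f'lip _ _) _; apply: ler_wpM2l => //.
    rewrite opprD addrA subrr add0r normrN.
    by have := normM_le_amgm 1 (xi t) eta0; rewrite mul1r expr1n mulr1.
  by rewrite avgZ avgZr avgD avg_cst// avgZr.
rewrite mulrCA -[leRHS]mulrA ler_wpM2l// mulrA ler_pM2r ?invr_gt0//.
rewrite mulrDr mulrC lerD2l mulrA -expr2.
by rewrite ler_pM2r ?invr_gt0.
Qed.

(** The offset [b] stands for an independent sum held fixed, as needed in [stein_two_sums]. *)
Lemma stein_iid_sum (I T : finType) (xi : T -> R) (b eta : R) :
  (0 < #|T|)%N -> avg xi = 0 -> 0 < eta ->
  `|avg (fun w : {ffun I -> T} => (\sum_i xi (w i)) * f (\sum_i xi (w i) + b)) -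
    #|I|%:R * avg (fun t => xi t ^+ 2) * avg (fun w : {ffun I -> T} => f' (\sum_i xi (w i) + b))| <=
  K * (#|I|%:R * (eta * avg (fun t => xi t ^+ 2) + avg (fun t => xi t ^+ 4) / eta)).
Proof.
move=> T0 xi0 eta0; pose S (w : {ffun I -> T}) := \sum_i xi (w i).
rewrite -[X in avg X - _]/(fun w => S w * f (S w + b)).
rewrite -[X in _ * avg X]/(fun w => f' (S w + b)).
set v := avg (fun t => xi t ^+ 2).
have -> : avg (fun w : {ffun I -> T} => S w * f (S w + b)) - #|I|%:R * v * avg (fun w : {ffun I -> T} => f' (S w + b)) =
  \sum_(j : I) (avg (fun w : {ffun I -> T} => xi (w j) * f (S w + b)) - v * avg (fun w : {ffun I -> T} => f' (S w + b))).
  rewrite sumrB sumr_const -[in RHS]mulr_natl mulrA -avg_sum; congr (_ - _).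
  by apply: eq_avg => w; rewrite -mulr_suml.
rewrite (le_trans (ler_norm_sum _ _ _))//.
rewrite [leRHS]mulrCA [leRHS]mulr_natl -sumr_const; apply: ler_sum => j _.
have -> : avg (fun w : {ffun I -> T} => xi (w j) * f (S w + b)) = _ :=
  avg_sum_split T0 xi j (fun t s => xi t * f (s + b)).
have -> : avg (fun w : {ffun I -> T} => f' (S w + b)) = _ :=
  avg_sum_split T0 xi j (fun t s => f' (s + b)).
rewrite /= -avgZ -avgB (le_trans (ler_norm_avg _))//.
rewrite -[leRHS](avg_cst (T := {ffun I -> T})) ?card_ffun_gt0//.
apply: ler_avg => w.
have -> : avg (fun t => xi t * f (sum_but xi j w + xi t + b)) =
  avg (fun t => xi t * f (sum_but xi j w + b + xi t)).
  by apply: eq_avg => t; rewrite addrAC.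
have -> : avg (fun t => f' (sum_but xi j w + xi t + b)) =
  avg (fun t => f' (sum_but xi j w + b + xi t)).
  by apply: eq_avg => t; rewrite addrAC.
exact: stein_step.
Qed.

(** [D] may depend on [V] in any way: the increments are controlled by [|D|] and [|V * D|], and
    AM-GM leaves second moments only. *)
Lemma stein_perturb (Om : finType) (V D : Om -> R) (eta : R) :
  (0 < #|Om|)%N -> 0 < eta ->
  `|avg (fun w => f' (V w + D w) - (V w + D w) * f (V w + D w)) -
    avg (fun w => f' (V w) - V w * f (V w))| <=
  K * (eta * (1 + avg (fun w => V w ^+ 2)) + 2 * avg (fun w => D w ^+ 2) / eta).
Proof.
move=> Om0 eta0; case: (ff') => fK f'K flip f'lip _.
have K0 := stein_class_ge0.
rewrite -avgB (le_trans (ler_norm_avg _))//.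
apply: (@le_trans _ _ (avg (fun w =>
   K * (eta * (1 + V w ^+ 2) + D w ^+ 2 * (2 / eta))))); last first.
  rewrite avgZ avgD avgZ avgD avg_cst// avgZr.
  by rewrite [2 * _ / _]mulrAC [2 / _ * _]mulrC.
apply: ler_avg => w; move: (V w) (D w) => x d.
have -> : f' (x + d) - (x + d) * f (x + d) - (f' x - x * f x) =
  (f' (x + d) - f' x) - d * f (x + d) - x * (f (x + d) - f x) by ring.
have h1 : `|f' (x + d) - f' x| <= K * `|d|.
  by have := f'lip (x + d) x; rewrite addrAC subrr add0r.
have h2 : `|d * f (x + d)| <= K * `|d|.
  by rewrite normrM mulrC ler_wpM2r.
have h3 : `|x * (f (x + d) - f x)| <= K * `|x * d|.
  rewrite normrM normrM mulrCA ler_wpM2l//.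
  by have := flip (x + d) x; rewrite addrAC subrr add0r.
apply: le_trans (ler_normB _ _) _.
apply: le_trans (lerD (ler_normB _ _) (lexx _)) _.
apply: le_trans (lerD (lerD h1 h2) h3) _.
rewrite -!mulrDr ler_wpM2l//.
have := normM_le_amgm 1 d eta0; rewrite mul1r expr1n mulr1.
have := normM_le_amgm x d eta0.
have : 0 <= d ^+ 2 / eta by rewrite divr_ge0 ?sqr_ge0 ?ltW.
have -> : d ^+ 2 * (2 / eta) = 2 * (d ^+ 2 / eta) by ring.
have : 0 <= eta * x ^+ 2 by rewrite mulr_ge0 ?sqr_ge0 ?ltW.
rewrite mulrDr mulr1; set a := d ^+ 2 / eta; set e := eta * _; lra.
Qed.

End SteinBounds.

Lemma avg_pair (R : realFieldType) (T1 T2 : finType) (g : T1 -> T2 -> R) :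
  avg (fun p : T1 * T2 => g p.1 p.2) = avg (fun x => avg (g x)).
Proof.
rewrite /avg -[in RHS]mulr_suml pair_bigA card_prod natrM -mulrA -invfM.
by rewrite [X in _ = _ / X]mulrC.
Qed.

Section SteinCombined.
Context (R : realFieldType) (K : R) (f f' : R -> R).
Hypothesis ff' : stein_class K f f'.

(** For each frozen [w] the terms are i.i.d., but the variance is [v w] instead of 1. As [f'] is
    bounded by [K], the replacement costs [K * |v w - 1|], so only the mean absolute deviation of
    the conditional variance matters. *)
Lemma stein_conditional (X J T : finType) (xi : X -> T -> R) (eta : R) :
  (0 < #|T|)%N -> (0 < #|X|)%N -> (forall w, avg (xi w) = 0) -> 0 < eta ->
  let S w (z : {ffun J -> T}) := \sum_j xi w (z j) in
  let v w := #|J|%:R * avg (fun y => xi w y ^+ 2) in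
  let d := avg (fun w => `|v w - 1|) in
  avg (fun w => avg (fun z => S w z ^+ 2)) <= 1 + d /\
  `|avg (fun w => avg (fun z => f' (S w z) - S w z * f (S w z)))| <=
  K * (d + eta * (1 + d) +
    #|J|%:R * avg (fun w => avg (fun y => xi w y ^+ 4)) / eta).
Proof.
move=> T0 X0 xi0 eta0 S v d; have K0 := stein_class_ge0 ff'.
have Z0 : (0 < #|{ffun J -> T}|)%N by exact: card_ffun_gt0.
have vd : avg v <= 1 + d.
  rewrite -[1](avg_cst (T := X))// -avgD; apply: ler_avg => w.
  by have := ler_norm (v w - 1); lra.
have SE : avg (fun w => avg (fun z => S w z ^+ 2)) = avg v.
  by apply: eq_avg => w; rewrite /S avg_sum_sqr.
split; first by rewrite SE.
rewrite (le_trans (ler_norm_avg _))//.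
apply: (@le_trans _ _ (avg (fun w => K * (`|v w - 1| + eta * v w +
  #|J|%:R * avg (fun y => xi w y ^+ 4) / eta)))); last first.
  rewrite avgZ ler_wpM2l// !avgD avgZ avgZr avgZ -/d lerD2r lerD2l.
  by rewrite ler_wpM2l// ltW.
apply: ler_avg => w; rewrite avgB.
have := stein_iid_sum ff' J 0 T0 (xi0 w) eta0.
rewrite (eq_avg (g := fun z => _ * f _) (h := fun z => S w z * f (S w z))); last first.
  by move=> z; rewrite addr0.
rewrite (eq_avg (g := fun z => f' _) (h := fun z => f' (S w z))); last first.
  by move=> z; rewrite addr0.
rewrite -/(v w); set a := avg _; set b := avg (fun z => f' _) => h.
have bK : `|b| <= K.
  rewrite (le_trans (ler_norm_avg _))//; apply: avg_le_cst => // z.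
  by case: ff' => _ ->.
rewrite (_ : b - a = - (v w - 1) * b - (a - v w * b)); last by ring.
rewrite (le_trans (ler_normB _ _))// -[X in K * X]addrA mulrDr lerD//.
  by rewrite normrM normrN mulrC ler_wpM2r.
apply: le_trans h _.
by rewrite (_ : _ * (_ + _) = eta * v w + #|J|%:R * avg (fun y => xi w y ^+ 4) / eta);
  last by rewrite /v; ring.
Qed.

(** The one-sum estimate is applied to each sum with the other held fixed; the two variances then
    multiply the same average of [f'] and add up to [v]. *)
Lemma stein_two_sums (I J T : finType) (a b : T -> R) (eta : R) :
  (0 < #|T|)%N -> avg a = 0 -> avg b = 0 -> 0 < eta ->
  let S (w : {ffun I -> T}) (z : {ffun J -> T}) :=
    \sum_i a (w i) + \sum_j b (z j) in
  let v := #|I|%:R * avg (fun y => a y ^+ 2) +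
    #|J|%:R * avg (fun y => b y ^+ 2) in
  let d := `|v - 1| in
  avg (fun w => avg (fun z => S w z ^+ 2)) = v /\
  `|avg (fun w => avg (fun z => f' (S w z) - S w z * f (S w z)))| <=
  K * (d + eta * (1 + d) + (#|I|%:R * avg (fun y => a y ^+ 4) +
    #|J|%:R * avg (fun y => b y ^+ 4)) / eta).
Proof.
move=> T0 a0 b0 eta0 S v d; have K0 := stein_class_ge0 ff'.
have X0 : (0 < #|{ffun I -> T}|)%N by exact: card_ffun_gt0.
have Z0 : (0 < #|{ffun J -> T}|)%N by exact: card_ffun_gt0.
pose SA (w : {ffun I -> T}) := \sum_i a (w i).
pose SB (z : {ffun J -> T}) := \sum_j b (z j).
have SB0 : avg SB = 0 by rewrite avg_sum big1// => j _; rewrite avg_coord.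
split.
  transitivity (avg (fun w => SA w ^+ 2 + avg (fun z => SB z ^+ 2))).
    apply: eq_avg => w.
    rewrite (eq_avg (h := fun z => SA w ^+ 2 + (2 * SA w * SB z + SB z ^+ 2))).
      by rewrite avgD avg_cst// avgD avgZ SB0 mulr0 add0r.
    by move=> z; rewrite /S -/(SA w) -/(SB z); ring.
  by rewrite avgD avg_cst// !avg_sum_sqr.
pose va := avg (fun y => a y ^+ 2); pose vb := avg (fun y => b y ^+ 2).
pose ka := avg (fun y => a y ^+ 4); pose kb := avg (fun y => b y ^+ 4).
pose m : R := #|I|%:R; pose n : R := #|J|%:R.
have vE : v = m * va + n * vb by [].
rewrite -/ka -/kb -/m -/n.
set E := avg (fun w => avg (fun z => f' (S w z))).
have EK : `|E| <= K.
  rewrite (le_trans (ler_norm_avg _))//; apply: avg_le_cst => // w.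
  rewrite (le_trans (ler_norm_avg _))//; apply: avg_le_cst => // z.
  by case: ff' => _ ->.
have hA : `|avg (fun w => avg (fun z => SA w * f (S w z))) - m * va * E| <=
    K * (m * (eta * va + ka / eta)).
  have -> : E = _ := exchange_avg (fun w z => f' (S w z)).
  rewrite exchange_avg -avgZ -avgB.
  rewrite (le_trans (ler_norm_avg _))// -[leRHS](avg_cst (T := {ffun J -> T}))//.
  by apply: ler_avg => z; exact: (stein_iid_sum ff' I (SB z) T0 a0 eta0).
have hB : `|avg (fun w => avg (fun z => SB z * f (S w z))) - n * vb * E| <=
    K * (n * (eta * vb + kb / eta)).
  rewrite /E -avgZ -avgB.
  rewrite (le_trans (ler_norm_avg _))// -[leRHS](avg_cst (T := {ffun I -> T}))//.
  apply: ler_avg => w; have := stein_iid_sum ff' J (SA w) T0 b0 eta0.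
  rewrite (eq_avg (g := fun z => _ * f _) (h := fun z => SB z * f (S w z))); last first.
    by move=> z; rewrite [_ + SA w]addrC.
  rewrite (eq_avg (g := fun z => f' _) (h := fun z => f' (S w z)))//.
  by move=> z; rewrite [_ + SA w]addrC.
rewrite (_ : avg _ = (1 - v) * E -
   (avg (fun w => avg (fun z => SA w * f (S w z))) - m * va * E) -
   (avg (fun w => avg (fun z => SB z * f (S w z))) - n * vb * E)); last first.
  rewrite (eq_avg (h := fun w => avg (fun z => f' (S w z)) -
    (avg (fun z => SA w * f (S w z)) + avg (fun z => SB z * f (S w z))))).
    by rewrite avgB avgD -/E vE; ring.
  move=> w; rewrite avgB -avgD; congr (_ - _); apply: eq_avg => z.
  by rewrite /S mulrDl.
apply: le_trans (ler_normB _ _) _.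
apply: le_trans (lerD (ler_normB _ _) hB) _.
apply: le_trans (lerD (lerD (lexx _) hA) (lexx _)) _.
have h1 : `|(1 - v) * E| <= K * d.
  by rewrite normrM distrC mulrC ler_wpM2r.
apply: le_trans (lerD (lerD h1 (lexx _)) (lexx _)) _.
rewrite -!mulrDr ler_wpM2l// -!addrA lerD2l.
rewrite (_ : m * (eta * va + ka / eta) + n * (eta * vb + kb / eta) =
  eta * v + (m * ka + n * kb) / eta); last by rewrite vE; ring.
rewrite lerD2r ler_wpM2l ?(ltW eta0)//.
by have := ler_norm (v - 1); rewrite -/d; lra.
Qed.

(** The 9 in multiples of [eta]: [d], [eta * (1 + d)] and [k / eta] give 1 + 2 + 1; the perturbation
    gives [eta * (2 + d)], at most 3, and [2 * e / eta], at most 2. *)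
Lemma stein_combine (Om : finType) (V D : Om -> R) (eta d k e : R) :
  (0 < #|Om|)%N -> 0 < eta <= 1 -> 0 <= d <= eta ^+ 2 -> k <= eta ^+ 2 ->
  e <= eta ^+ 2 ->
  avg (fun w => V w ^+ 2) <= 1 + d -> avg (fun w => D w ^+ 2) <= e ->
  `|avg (fun w => f' (V w) - V w * f (V w))| <= K * (d + eta * (1 + d) + k / eta) ->
  `|avg (fun w => f' (V w + D w) - (V w + D w) * f (V w + D w))| <= K * (9 * eta).
Proof.
move=> Om0 /andP[eta0 eta1] /andP[d0 de] ke ee VV DD hV.
have K0 := stein_class_ge0 ff'.
have hD := stein_perturb ff' V D Om0 eta0.
set a := avg _ in hD *; set b := avg _ in hD hV.
rewrite -(subrK b a) (le_trans (ler_normD _ _))//.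
apply: le_trans (lerD hD hV) _.
rewrite -mulrDr ler_wpM2l//.
have e2 : eta ^+ 2 <= eta by rewrite expr2 ler_piMr// ltW.
have e3 : eta * d <= eta by rewrite ler_piMr ?(ltW eta0)// (le_trans de)// (le_trans e2).
have k1 : k / eta <= eta by rewrite ler_pdivrMr// -expr2.
have D1 : 2 * avg (fun w => D w ^+ 2) / eta <= 2 * eta.
  by rewrite ler_pdivrMr// -mulrA -expr2 ler_wpM2l// (le_trans DD).
have V1 : eta * (1 + avg (fun w => V w ^+ 2)) <= eta * (1 + (1 + d)).
  by rewrite ler_wpM2l ?(ltW eta0)// lerD2l.
lra.
Qed.

End SteinCombined.

(** * Solution of the Stein equation *)

Section MeanValue.
Context (R : realType).
Implicit Types f df : R -> R.

Lemma mean_value f df (x y : R) : (forall z : R, is_derive z 1 f (df z)) ->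
  exists2 z, Num.min x y <= z <= Num.max x y & f y - f x = df z * (y - x).
Proof.
move=> fdf.
have fc a b : {within `[a, b], continuous f}.
  apply: continuous_subspaceT => z; apply: differentiable_continuous.
  exact/derivable1_diffP.
have [xy|yx] := leP x y.
  have [z zxy E] := MVT_segment xy (fun z _ => fdf z) (@fc x y).
  by exists z => //; move: zxy; rewrite in_itv.
have [z zxy E] := MVT_segment (ltW yx) (fun z _ => fdf z) (@fc y x).
exists z; first by move: zxy; rewrite in_itv.
by rewrite -opprB E -mulrN opprB.
Qed.

Lemma derive_bounded_lipschitz f df (K : R) :
  (forall z : R, is_derive z 1 f (df z)) -> (forall z, `|df z| <= K) ->
  forall x y, `|f x - f y| <= K * `|x - y|.
Proof.
move=> fdf dfK x y; have [z _ ->] := mean_value y x fdf.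
by rewrite normrM ler_wpM2r.
Qed.

Lemma derive_lipschitz_taylor f df (K : R) :
  (forall z : R, is_derive z 1 f (df z)) ->
  (forall x y, `|df x - df y| <= K * `|x - y|) ->
  forall u x, `|f (u + x) - f u - x * df u| <= K * x ^+ 2.
Proof.
move=> fdf dfL u x; have [z] := mean_value u (u + x) fdf.
rewrite ge_min le_max => /andP[z1 z2] ->.
have K0 : 0 <= K.
  by rewrite -[K]mulr1 -[X in K * X](normr1 R) -[X in K * `|X|]subr0 (le_trans _ (dfL 1 0)).
rewrite addrAC subrr add0r [x * _]mulrC -mulrBl normrM.
rewrite -[x ^+ 2]real_normK ?num_real// expr2 mulrA ler_wpM2r//.
rewrite (le_trans (dfL _ _))// ler_wpM2l// ler_norml.
have := ler_norm x; have := ler_norm (- x); rewrite normrN.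
by case/orP: z1; case/orP: z2; lra.
Qed.

(** Serves to differentiate the squared positive part, including at its kink. *)
Lemma is_derive_quadratic f (u d C : R) :
  (forall x, `|f (u + x) - f u - x * d| <= C * x ^+ 2) -> is_derive u 1 f d.
Proof.
move=> fuC.
have cvgd : h^-1 *: ((f \o shift u) (h *: (1 : R)) - f u) @[h --> 0^'] --> d.
  apply/cvgrPdist_le => e e0; near=> h.
  have h0 : h != 0 by near: h; exact: nbhs_dnbhs_neq.
  rewrite /= distrC [h%:A]mulr1 [h + u]addrC.
  have -> : h^-1 *: (f (u + h) - f u) - d = h^-1 * (f (u + h) - f u - h * d).
    by rewrite mulrBr mulrA mulVf// mul1r.
  rewrite normrM normfV ler_pdivrMl ?normr_gt0//.
  apply: le_trans (fuC h) _; rewrite -real_normK ?num_real// expr2 mulrCA.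
  rewrite ler_wpM2l//.
  have := ler_norm C; have := normr_ge0 C; have := normr_ge0 h.
  suff : `|h| * (`|C| + 1) <= e by nra.
  rewrite -ler_pdivlMr; last by rewrite (@lt_le_trans _ _ 1)// lerDr.
  near: h; apply: dnbhs0_le; rewrite divr_gt0//.
by apply: DeriveDef; [apply/cvg_ex; exists d|exact/cvg_lim].
Unshelve. all: by end_near. Qed.

(** If [D x < 0], monotonicity keeps [D] below [D x] from there on, against the eventual bound with
    [e = - D x / 2]. The Gaussian tail bounds below are all instances. *)
Lemma derive_le0_lim_ge0 (D dD : R -> R) (x : R) :
  (forall z : R, x <= z -> is_derive z 1 D (dD z)) ->
  (forall z, x <= z -> dD z <= 0) ->
  (forall e, 0 < e -> \forall y \near +oo, - e <= D y) -> 0 <= D x.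
Proof.
move=> DdD dD0 Dlim; rewrite leNgt; apply/negP => Dx0.
have e0 : 0 < - D x / 2 by rewrite divr_gt0// oppr_gt0.
near (@pinfty_nbhs R) => y.
have Dy : - (- D x / 2) <= D y by near: y; exact: Dlim.
have xy : x <= y by near: y; apply: nbhs_pinfty_ge; exact: num_real.
have Dxy z : z \in `]x, y[ -> is_derive z 1 D (dD z).
  by rewrite in_itv/= => /andP[/ltW xz _]; exact: DdD.
have Dc : {within `[x, y], continuous D}.
  apply: continuous_in_subspaceT => z.
  rewrite inE/= in_itv/= => /andP[xz _]; apply: differentiable_continuous.
  by apply/derivable1_diffP; have := DdD _ xz; case.
have [z] := MVT_segment xy Dxy Dc; rewrite in_itv/= => /andP[xz _] E.
have : dD z * (y - x) <= 0 by rewrite mulr_le0_ge0 ?subr_ge0// dD0.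
lra.
Unshelve. all: by end_near. Qed.

End MeanValue.

Lemma is_derive_div (R : realType) (f g : R -> R) (x df dg : R) :
  g x != 0 -> is_derive x 1 f df -> is_derive x 1 g dg ->
  is_derive x 1 (fun z => f z / g z) ((df * g x - f x * dg) / g x ^+ 2).
Proof.
move=> gx0 fdf gdg.
have dV := is_deriveV gx0 gdg.
have -> : (fun z => f z / g z) = f * (fun z => (g z)^-1) by [].
by apply: is_derive_eq; rewrite /GRing.scale/=; field.
Qed.

(** * Mills ratio bounds for a Gaussian tail *)

Section Mills.
Context (R : realType) (kap : R) (Psi : R -> R).
Let phi w : R := kap * expR (- (w ^+ 2 / 2)).
Hypothesis kap_gt0 : 0 < kap.
Hypothesis dPsi : forall w : R, is_derive w 1 Psi (- phi w).
Hypothesis Psiy0 : Psi w @[w --> +oo] --> 0.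

Let phi_ge0 w : 0 <= phi w.
Proof. by rewrite mulr_ge0 ?expR_ge0 ?ltW. Qed.

Let phi_le w : phi w <= kap.
Proof.
rewrite /phi ler_piMr ?(ltW kap_gt0)// -[leRHS]expR0 ler_expR oppr_le0.
by rewrite divr_ge0 ?sqr_ge0.
Qed.

Let dphi (w : R) : is_derive w 1 phi (- (w * phi w)).
Proof.
rewrite /phi; apply: trigger_derive; rewrite /GRing.scale/=; by field.
Qed.

Let Psi_small e : 0 < e -> \forall y \near +oo, - e <= Psi y <= e.
Proof.
move=> e0; move/cvgrPdist_le : Psiy0 => /(_ e e0); apply: filterS => y.
by rewrite sub0r normrN ler_norml.
Qed.

(** [Psi] stays abstract so that both the right tail [1 - Phi] and the reflected left tail
    [Phi (- w)] can be substituted for it. *)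
Lemma gauss_tail_ge0 w : 0 <= Psi w.
Proof.
apply: (@derive_le0_lim_ge0 _ Psi (fun w => - phi w)) => // [z _|e e0].
  by rewrite oppr_le0.
by apply: filterS (Psi_small e0) => y /andP[].
Qed.

Lemma mills_upper w : 0 < w -> w * Psi w <= phi w.
Proof.
move=> w0; rewrite mulrC -ler_pdivlMr// -subr_ge0.
apply: (@derive_le0_lim_ge0 _ (fun z => phi z / z - Psi z)
  (fun z => - (phi z / z ^+ 2))).
- move=> z wz; have z0 : z != 0 by rewrite gt_eqF// (lt_le_trans w0).
  have := is_derive_div z0 (dphi z) (is_derive_id z 1).
  by move=> dq; apply: trigger_derive; field.
- by move=> z _; rewrite oppr_le0 divr_ge0 ?sqr_ge0.
- move=> e e0; near=> y.
  have y0 : 0 < y by near: y; apply: nbhs_pinfty_gt; exact: num_real.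
  have : 0 <= phi y / y by rewrite divr_ge0// ltW.
  have /andP[_] : - e <= Psi y <= e by near: y; exact: Psi_small.
  lra.
Unshelve. all: by end_near. Qed.

(** This second-order precision is needed for the derivative of [w * f w], in which the leading
    terms of the Stein solution cancel. *)
Lemma mills_lower w : 0 < w -> w * phi w <= (1 + w ^+ 2) * Psi w.
Proof.
move=> w0; have s0 z : 0 < 1 + z ^+ 2 :> R by rewrite ltr_pwDl// sqr_ge0.
rewrite mulrC [leRHS]mulrC -ler_pdivrMr// -subr_ge0.
apply: (@derive_le0_lim_ge0 _ (fun z => Psi z - phi z * z / (1 + z ^+ 2))
  (fun z => - (2 * phi z / (1 + z ^+ 2) ^+ 2))).
- move=> z wz; have z0 : 1 + z ^+ 2 != 0 by rewrite gt_eqF.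
  have dn : is_derive z 1 (fun z => phi z * z) (phi z * (1 - z ^+ 2)).
    by apply: trigger_derive; rewrite /phi /GRing.scale/=; field.
  have dd : is_derive z 1 (fun z => 1 + z ^+ 2) (2 * z).
    by apply: trigger_derive; rewrite /GRing.scale/=; ring.
  have dq := @is_derive_div _ _ (fun z => 1 + z ^+ 2) _ _ _ z0 dn dd.
  by apply: trigger_derive; field; rewrite z0.
- by move=> z _; rewrite oppr_le0 divr_ge0 ?sqr_ge0// mulr_ge0.
- move=> e e0; near=> y.
  have y0 : kap / e < y by near: y; apply: nbhs_pinfty_gt; exact: num_real.
  have y1 : 0 < y by rewrite (le_lt_trans _ y0)// divr_ge0 ?ltW.
  have Py := gauss_tail_ge0 y.
  suff : phi y * y / (1 + y ^+ 2) <= e by lra.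
  rewrite ler_pdivrMr//; move: y0; rewrite ltr_pdivrMr// => y0.
  have := phi_le y; have := phi_ge0 y; nra.
Unshelve. all: by end_near. Qed.

End Mills.

Section SteinSolution.
Context (R : realType) (kap : R) (Phi : R -> R).
Let phi w : R := kap * expR (- (w ^+ 2 / 2)).
Hypothesis kap_gt0 : 0 < kap.
Hypothesis dPhi : forall w : R, is_derive w 1 Phi (phi w).
Hypothesis PhiNy : Phi w @[w --> -oo] --> (0 : R).
Hypothesis Phiy : Phi w @[w --> +oo] --> (1 : R).

Let phi_gt0 w : 0 < phi w.
Proof. by rewrite mulr_gt0 ?expR_gt0. Qed.

Let dphi (w : R) : is_derive w 1 phi (- (w * phi w)).
Proof.
by rewrite /phi; apply: trigger_derive; rewrite /GRing.scale/=; field.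
Qed.

Let phi_le w : phi w <= kap.
Proof.
rewrite /phi ler_piMr ?(ltW kap_gt0)// -[leRHS]expR0 ler_expR oppr_le0.
by rewrite divr_ge0 ?sqr_ge0.
Qed.

Let phiN w : phi (- w) = phi w. Proof. by rewrite /phi sqrrN. Qed.

Let right_tail (w : R) : is_derive w 1 (fun z => 1 - Phi z) (- phi w).
Proof. by apply: trigger_derive; ring. Qed.

Let right_tail0 : (fun z => 1 - Phi z) w @[w --> +oo] --> (0 : R).
Proof. by rewrite -(subrr (1 : R)); apply: cvgB => //; exact: cvg_cst. Qed.

Let left_tail (w : R) : is_derive w 1 (fun z => Phi (- z)) (- phi w).
Proof.
by rewrite -phiN -mulrN1; exact: (@is_derive1_comp _ Phi -%R w _ _).
Qed.

Let left_tail0 : (fun z => Phi (- z)) w @[w --> +oo] --> (0 : R).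
Proof. by rewrite -[X in X @ _](_ : Phi \o -%R = _)// -cvgNy_compNP. Qed.

Lemma gauss_cdf_ge0 w : 0 <= Phi w.
Proof.
by have := gauss_tail_ge0 kap_gt0 left_tail left_tail0 (- w); rewrite opprK.
Qed.

Lemma gauss_cdf_le1 w : Phi w <= 1.
Proof.
by have := gauss_tail_ge0 kap_gt0 right_tail right_tail0 w; rewrite subr_ge0.
Qed.

Lemma gauss_cdf_lt x y : x < y -> Phi x < Phi y.
Proof.
move=> xy; have [z _ E] := mean_value x y dPhi.
by rewrite -subr_gt0 E mulr_gt0// subr_gt0.
Qed.

Let gauss_cdf_le x y : x <= y -> Phi x <= Phi y.
Proof.
by rewrite le_eqVlt => /predU1P[->//|/gauss_cdf_lt/ltW].
Qed.

Let pos (u : R) := Num.max u 0.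

Let pos_sqr_taylor u x : `|pos (u + x) ^+ 2 - pos u ^+ 2 - x * (2 * pos u)| <= 1 * x ^+ 2.
Proof.
rewrite mul1r /pos ler_norml.
by case: (leP u 0) => u0; case: (leP (u + x) 0) => ux0; apply/andP; split; nra.
Qed.

Let pos_lipschitz u v : `|pos u - pos v| <= `|u - v|.
Proof.
rewrite /pos ler_norml.
have := ler_norm (u - v); have := ler_norm (- (u - v)); rewrite normrN.
by case: (leP u 0) => u0; case: (leP v 0) => v0 h1 h2; apply/andP; split; lra.
Qed.

Context (a b : R).
Hypothesis ab : a < b.
Let al := Phi a.
Let be := Phi b.
(** The Gaussian mean of the test function: the integral of the ramp [tau] over [[0, 1]], that is
    [Tau 1]. *)
Let c := (al + be) / 2.
Let al_be : 0 < be - al. Proof. by rewrite subr_gt0 gauss_cdf_lt. Qed.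
Let al_be0 : be - al != 0. Proof. by rewrite gt_eqF. Qed.

(** [tau] is the ramp falling linearly from 1 at [al] to 0 at [be], and [Tau] is its antiderivative
    vanishing at 0. Positive parts give both a single formula on the whole line. *)
Let tau u := (pos (be - u) - pos (al - u)) / (be - al).
Let Tau u := (be ^+ 2 - pos (be - u) ^+ 2 - al ^+ 2 + pos (al - u) ^+ 2)
  / (2 * (be - al)).

Let dTau (u : R) : is_derive u 1 Tau (tau u).
Proof.
have dpos e : is_derive u 1 (fun u => pos (e - u) ^+ 2) (- 2 * pos (e - u)).
  apply: (@is_derive_quadratic _ _ _ _ 1) => x.
  have := pos_sqr_taylor (e - u) (- x); rewrite opprD addrA sqrrN.
  by rewrite (_ : - x * _ = x * (- 2 * pos (e - u))); last by ring.
have d1 := dpos be; have d2 := dpos al.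
have -> : Tau = fun u => (2 * (be - al))^-1 *
  (be ^+ 2 - pos (be - u) ^+ 2 - al ^+ 2 + pos (al - u) ^+ 2).
  by apply/funext => v; rewrite mulrC.
apply: trigger_derive; rewrite /tau /GRing.scale/=.
by field.
Qed.

Let tau01 u : 0 <= tau u <= 1.
Proof.
rewrite /tau ler_pdivlMr// ler_pdivrMr// mul0r mul1r /pos; have := al_be.
by case: (leP (be - u) 0) => u0; case: (leP (al - u) 0) => v0 h1; lra.
Qed.

Let tau_left u : u <= al -> tau u = 1.
Proof.
move=> ual; rewrite /tau /pos.
rewrite !max_l ?subr_ge0//; first by field.
by rewrite (le_trans ual)// -subr_ge0 ltW.
Qed.

Let tau_right u : be <= u -> tau u = 0.
Proof.
move=> ube; rewrite /tau /pos.
rewrite !max_r ?subr_le0// ?subrr ?mul0r//.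
by rewrite (le_trans _ ube)// -subr_ge0 ltW.
Qed.

Let Tau_left u : u <= al -> Tau u = u.
Proof.
move=> ual; rewrite /Tau /pos.
rewrite !max_l ?subr_ge0//; first by field.
by rewrite (le_trans ual)// -subr_ge0 ltW.
Qed.

Let Tau_right u : be <= u -> Tau u = c.
Proof.
move=> ube; rewrite /Tau /pos /c.
rewrite !max_r ?subr_le0//; first by field.
by rewrite (le_trans _ ube)// -subr_ge0 ltW.
Qed.

(** [G w] is the Gaussian integral of [h - c] from minus infinity to [w], in closed form because
    [Tau (Phi w)] has derivative [h w * phi w]. Thus [f] is the classical Stein solution with no
    integral left, and [f'] is read off the Stein equation. *)
Let G w := Tau (Phi w) - c * Phi w.
Let f w := G w / phi w.
Let h w := tau (Phi w).
Let f' w := w * f w + (h w - c).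

Let df (w : R) : is_derive w 1 f (f' w).
Proof.
have dT : is_derive w 1 (fun z => Tau (Phi z)) (tau (Phi w) * phi w).
  exact: (@is_derive1_comp _ Tau Phi w _ _ (dTau _) (dPhi w)).
have dG : is_derive w 1 G ((tau (Phi w) - c) * phi w).
  by apply: trigger_derive; rewrite /GRing.scale/=; ring.
have phi0 : phi w != 0 by rewrite gt_eqF.
have dq := @is_derive_div _ G phi w _ _ phi0 dG (dphi w).
by apply: (is_derive_eq dq); rewrite /f' /f /h; field.
Qed.

Let c01 : 0 <= c <= 1.
Proof.
have := gauss_cdf_ge0 a; have := gauss_cdf_ge0 b.
have := gauss_cdf_le1 a; have := gauss_cdf_le1 b.
rewrite /c -/al -/be; lra.
Qed.

(* The second derivative of the solution, away from the contribution of [h]. *)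
Let Q w := f w + w * f' w.

Let B := Num.max 1 (Num.max `|a| `|b|).

(** With [N] the Mills ratio, these are the quantities to which [f], [f'] and [Q] reduce on the
    tails, up to sign and a factor [c] or [1 - c]. *)
Let tail_bounds (M x : R) : 0 < x -> 0 <= M -> x * M <= phi x ->
  x * phi x <= (1 + x ^+ 2) * M -> 1 <= x ->
  let N := M / phi x in
  [/\ 0 <= N <= 1, 0 <= 1 - x * N <= 1 & 0 <= (1 + x ^+ 2) * N - x <= 1].
Proof.
move=> x0 M0 Mu Ml x1 N.
have N0 : 0 <= N by rewrite divr_ge0// ltW.
have Nu : x * N <= 1 by rewrite mulrA ler_pdivrMr// mul1r.
have Nl : x <= (1 + x ^+ 2) * N by rewrite mulrA ler_pdivlMr.
have xN : N <= x * N by rewrite ler_peMl.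
split; apply/andP; split; rewrite ?subr_ge0//; nra.
Qed.

(** Since [B] exceeds [|a|] and [|b|], [Phi w] lies outside the ramp, where [Tau] is constant or the
    identity; so [f] is a multiple of the Mills ratio at [|w|]. *)
Let far w : B <= `|w| -> [/\ `|f w| <= 1, `|f' w| <= 1 & `|Q w| <= 1].
Proof.
rewrite !ge_max => /and3P[w1 wa wb]; have /andP[c0 c1] := c01.
have [w0|w0] := leP 0 w.
  rewrite !(ger0_norm w0) in w1 wa wb.
  have bw : be <= Phi w by rewrite gauss_cdf_le// (le_trans _ wb)// ler_norm.
  have wp : 0 < w by rewrite (lt_le_trans ltr01).
  have [] := tail_bounds wp (gauss_tail_ge0 kap_gt0 right_tail right_tail0 w)
    (mills_upper kap_gt0 right_tail right_tail0 wp)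
    (mills_lower kap_gt0 right_tail right_tail0 wp) w1.
  set N := (1 - Phi w) / phi w => /andP[N0 N1] /andP[L0 L1] /andP[U0 U1].
  have fE : f w = c * N.
    by rewrite /f /G /N Tau_right// mulrA mulrBr mulr1.
  have f'E : f' w = - (c * (1 - w * N)).
    by rewrite /f' /h tau_right// fE; ring.
  have QE : Q w = c * ((1 + w ^+ 2) * N - w) by rewrite /Q f'E fE; ring.
  by rewrite QE f'E fE normrN (ger0_norm (mulr_ge0 c0 N0))
    (ger0_norm (mulr_ge0 c0 L0)) (ger0_norm (mulr_ge0 c0 U0)); split;
    exact: mulr_ile1.
rewrite (ltr0_norm w0) in w1 wa wb.
have bw : Phi w <= al.
  by apply: gauss_cdf_le; have := ler_norm (- a); rewrite normrN; lra.
have wp : 0 < - w by rewrite (lt_le_trans ltr01).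
have [] := tail_bounds wp (gauss_tail_ge0 kap_gt0 left_tail left_tail0 (- w))
  (mills_upper kap_gt0 left_tail left_tail0 wp)
  (mills_lower kap_gt0 left_tail left_tail0 wp) w1.
rewrite opprK phiN sqrrN.
set N := Phi w / _ => /andP[N0 N1] /andP[L0 L1] /andP[U0 U1].
have fE : f w = (1 - c) * N.
  by rewrite /f /G /N Tau_left//; ring.
have f'E : f' w = (1 - c) * (1 - - w * N).
  by rewrite /f' /h tau_left// fE; ring.
have QE : Q w = (1 - c) * ((1 + w ^+ 2) * N + w) by rewrite /Q f'E fE; ring.
have c2 : 0 <= 1 - c <= 1 by lra.
case/andP: c2 => c2 c3.
by rewrite QE f'E fE (ger0_norm (mulr_ge0 c2 N0))
  (ger0_norm (mulr_ge0 c2 L0)) (ger0_norm (mulr_ge0 c2 U0)); split;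
  exact: mulr_ile1.
Qed.

(** On [|w| <= B] the only danger is the division by [phi], which is smallest at [B]; [D] is the
    crude bound [4 / (be - al) + 1] for [|G|] divided by that minimum. *)
Let bounded : exists K : R, forall w, [/\ `|f w| <= K, `|f' w| <= K & `|Q w| <= K].
Proof.
pose D := (4 / (be - al) + 1) / (kap * expR (- (B ^+ 2 / 2))).
have B1 : 1 <= B by rewrite /B le_max lexx.
have D0 : 0 <= D.
  by rewrite divr_ge0 ?addr_ge0 ?divr_ge0 ?mulr_ge0 ?expR_ge0 ?ltW.
exists (1 + D + B * D + 1 + B * (B * D + 1)) => w.
have BD : 0 <= B * D by rewrite mulr_ge0// (le_trans ler01).
have BBD : 0 <= B * (B * D + 1) by rewrite mulr_ge0 ?addr_ge0// (le_trans ler01).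
have [wB|/ltW Bw] := leP `|w| B; last first.
  by have [h1 h2 h3] := far Bw; split; lra.
have fD : `|f w| <= D.
  rewrite /f /D normrM normfV (gtr0_norm (phi_gt0 w)).
  apply: ler_pM; rewrite ?invr_ge0 ?(ltW (phi_gt0 w))//.
    rewrite /G (le_trans (ler_normB _ _))// lerD//; last first.
      rewrite normrM !ger0_norm ?gauss_cdf_ge0//; last by case/andP: c01.
      by rewrite mulr_ile1 ?gauss_cdf_ge0 ?gauss_cdf_le1//; case/andP: c01.
    rewrite /Tau normrM normfV [`|2 * _|]gtr0_norm ?mulr_gt0//.
    rewrite ler_pdivrMr ?mulr_gt0// (_ : 4 / _ * _ = 8); last by field.
    have pos01 e : 0 <= e <= 1 -> 0 <= pos (e - Phi w) ^+ 2 <= 1.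
      move=> /andP[e0 e1]; rewrite sqr_ge0 /= expr_le1// /pos.
        by rewrite ge_max ler01 andbT lerBlDr (le_trans e1)// lerDl gauss_cdf_ge0.
      by rewrite le_max lexx orbT.
    have a01 : 0 <= al <= 1 by rewrite gauss_cdf_ge0 gauss_cdf_le1.
    have b01 : 0 <= be <= 1 by rewrite gauss_cdf_ge0 gauss_cdf_le1.
    have := pos01 _ a01; have := pos01 _ b01.
    set u := pos _ ^+ 2; set v := pos _ ^+ 2; rewrite ler_norml; nra.
  rewrite lef_pV2 ?posrE ?mulr_gt0 ?expR_gt0// ler_wpM2l ?(ltW kap_gt0)//.
  rewrite ler_expR lerN2 ler_pM2r// -real_normK ?num_real//.
  by rewrite lerXn2r ?nnegrE// (le_trans _ B1).
have f'D : `|f' w| <= B * D + 1.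
  rewrite /f' (le_trans (ler_normD _ _))// lerD//; first by rewrite normrM ler_pM.
  have /andP[t0 t1] := tau01 (Phi w); have /andP[c0 c1] := c01.
  by rewrite ler_norml /h; apply/andP; split; lra.
have QD : `|Q w| <= D + B * (B * D + 1).
  by rewrite /Q (le_trans (ler_normD _ _))// lerD// normrM ler_pM.
by split; lra.
Qed.

(** [f'] inherits the kinks of [h], so its Lipschitz bound is obtained in two pieces: [w * f w]
    through its derivative [Q], and [h] directly. The 2 in [2 / (be - al)] comes from treating the
    two positive parts in [tau] separately. *)
Lemma stein_solution : exists K f f' h c,
  [/\ stein_class K f f', forall w, f' w - w * f w = h w - c,
      forall w, (w <= a)%R%:R <= h w <= (w <= b)%R%:R & Phi a <= c <= Phi b].
Proof.
have [K0 bK] := bounded.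
pose K := K0 + 2 / (be - al) * kap.
have K00 : 0 <= K0 by have [h1 _ _] := bK 0; exact: le_trans h1.
have k0 : 0 <= 2 / (be - al) * kap by rewrite mulr_ge0 ?divr_ge0 ?ltW.
have K0K : K0 <= K by rewrite lerDl.
have hL x y : `|h x - h y| <= 2 / (be - al) * kap * `|x - y|.
  rewrite -mulrA mulrAC -/(h x); have PL : `|Phi x - Phi y| <= kap * `|x - y|.
    apply: derive_bounded_lipschitz dPhi _ _ _ => z.
    by rewrite gtr0_norm.
  rewrite /h /tau -mulrBl normrM normfV (gtr0_norm al_be).
  rewrite ler_pM2r ?invr_gt0//.
  have := pos_lipschitz (be - Phi x) (be - Phi y).
  have := pos_lipschitz (al - Phi x) (al - Phi y).
  have E (e u v : R) : e - u - (e - v) = - (u - v) by ring.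
  rewrite !E !normrN => h1 h2.
  rewrite (_ : _ - _ - _ = (pos (be - Phi x) - pos (be - Phi y)) -
    (pos (al - Phi x) - pos (al - Phi y))); last by ring.
  by rewrite (le_trans (ler_normB _ _))//; lra.
have dwf (w : R) : is_derive w 1 (fun z => z * f z) (Q w).
  have dfw := df w.
  by apply: trigger_derive; rewrite /Q /GRing.scale/=; ring.
have wfL x y : `|x * f x - y * f y| <= K0 * `|x - y|.
  by apply: derive_bounded_lipschitz dwf _ x y => z; case: (bK z).
have f'L x y : `|f' x - f' y| <= K * `|x - y|.
  rewrite (_ : _ - _ = (x * f x - y * f y) + (h x - h y)); last by rewrite /f'; ring.
  by rewrite (le_trans (ler_normD _ _))// /K mulrDl lerD.
exists K, f, f', h, c; split.
- split => //.
  + by move=> x; case: (bK x) => /le_trans ->.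
  + by move=> x; case: (bK x) => _ /le_trans ->.
  + apply: derive_bounded_lipschitz df _ => z.
    by case: (bK z) => _ /le_trans ->.
  + exact: derive_lipschitz_taylor df f'L.
- by move=> w; rewrite /f'; ring.
- move=> w; have /andP[t0 t1] := tau01 (Phi w); rewrite /h; apply/andP; split.
    by have [wa|_//] := leP w a; rewrite tau_left// gauss_cdf_le.
  by have [_//|/ltW wb] := leP w b; rewrite tau_right// gauss_cdf_le.
- by rewrite /c -/al -/be; move: al_be; lra.
Qed.

End SteinSolution.

(** * The standard normal cdf and the reduction to Stein bounds *)

Section NormalCdf.
Context (R : realType).

Definition normal_cdf (w : R) : R := fine (normal_prob 0 1 `]-oo, w]).

Lemma normal_cdfE w : (normal_cdf w)%:E = normal_prob 0 1 `]-oo, w].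
Proof. by rewrite /normal_cdf fineK// fin_num_measure. Qed.

Lemma normal_cdf_derive (w : R) :
  is_derive w 1 normal_cdf (normal_peak 1 * expR (- (w ^+ 2 / 2))).
Proof.
have int : lebesgue_measure.-integrable `]-oo, (w + 1)]
    (EFin \o normal_pdf 0 (1 : R)).
  by apply: (integrableS _ _ (subsetT _) (integrable_normal_pdf _ _)).
have w1 : w < w + 1 by rewrite ltrDl.
have := continuous_FTC1 w1 int (ltNyr w) (@continuous_normal_pdf R 0 1 (oner_neq0 R) w).
case=> dF F'; apply: DeriveDef; first exact: dF.
rewrite -derive1E [LHS]F' normal_pdfE ?oner_neq0//.
by rewrite /normal_fun subr0 expr1n mulNr.
Qed.

(** The identity seen as a random variable under the normal law, to which the general limits of a
    cdf at infinity apply. *)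
Let idR : measurableTypeR R -> R := idfun.

#[local] HB.instance Definition _ :=
  @isMeasurableFun.Build _ _ _ _ idR (@measurable_id _ _ setT).

Lemma normal_cdfy : normal_cdf w @[w --> +oo] --> (1 : R).
Proof.
have h := cvg_cdfy1 (idR : {RV (normal_prob 0 1) >-> R}).
exact: (fine_cvg h).
Qed.

Lemma normal_cdfNy : normal_cdf w @[w --> -oo] --> (0 : R).
Proof.
have h := cvg_cdfNy0 (idR : {RV (normal_prob 0 1) >-> R}).
exact: (fine_cvg h).
Qed.

End NormalCdf.

(** The indicator of []-oo, x]] is bracketed by the test functions of [stein_solution] for
    [[x - d, x]] and [[x, x + d]]. Their constant [K] does not depend on [k], so the accuracy can be
    chosen after it. *)
Lemma stein_method (R : realType) (Om : nat -> finType) (W : forall k, Om k -> R) :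
  (forall k, (0 < #|Om k|)%N) ->
  (forall e, 0 < e -> \forall k \near \oo, forall K f f', stein_class K f f' ->
    `|avg (fun w => f' (W k w) - W k w * f (W k w))| <= K * e) ->
  forall x : R, avg (fun w => (W k w <= x)%R%:R : R) @[k --> \oo] --> normal_cdf x.
Proof.
move=> Om0 WS x; apply/cvgrPdist_le => e e0.
have kap0 : 0 < normal_peak (1 : R) by rewrite normal_peak_gt0.
have sol :=
  stein_solution kap0 (@normal_cdf_derive R) (@normal_cdfNy R) (@normal_cdfy R).
have PL (u v : R) : `|normal_cdf u - normal_cdf v| <= normal_peak 1 * `|u - v|.
  apply: (@derive_bounded_lipschitz R _ _ _ (@normal_cdf_derive R)) => z.
  rewrite gtr0_norm ?mulr_gt0 ?expR_gt0// ler_piMr ?(ltW kap0)//.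
  by rewrite -[leRHS]expR0 ler_expR oppr_le0 divr_ge0 ?sqr_ge0.
(* The normal cdf is Lipschitz with constant [normal_peak 1], so it varies by at most [e / 2] over a
   distance [d]; the other [e / 2] is left for the Stein error. *)
pose d := e / 2 / normal_peak 1.
have d0 : 0 < d by rewrite !divr_gt0.
have near_h (a b : R) : a < b -> exists c, normal_cdf a <= c <= normal_cdf b /\
   \forall k \near \oo, avg (fun w => (W k w <= a)%R%:R : R) <= c + e / 2 /\
     c - e / 2 <= avg (fun w => (W k w <= b)%R%:R : R).
  move=> ab; have [K [f [f' [h [c [ff' fh hab cab]]]]]] := sol _ _ ab.
  exists c; split => //.
  have K0 := stein_class_ge0 ff'.
  have e1 : 0 < e / 2 / (K + 1) by rewrite !divr_gt0// ltr_wpDl.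
  near=> k.
  have Wk : `|avg (fun w => h (W k w)) - c| <= e / 2.
    apply: (@le_trans _ _ (K * (e / 2 / (K + 1)))); last first.
      by rewrite mulrA ler_pdivrMr ?ltr_wpDl// mulrC ler_wpM2l ?lerDl// divr_ge0 ?(ltW e0).
    rewrite -[c](avg_cst c (Om0 k)) -avgB.
    rewrite -(eq_avg (fun w => fh (W k w))).
    by near: k; apply: filterS (WS _ e1) => k; apply.
  have h1 : avg (fun w => (W k w <= a)%R%:R) <= avg (fun w => h (W k w)).
    by apply: ler_avg => w; case/andP: (hab (W k w)).
  have h2 : avg (fun w => h (W k w)) <= avg (fun w => (W k w <= b)%R%:R).
    by apply: ler_avg => w; case/andP: (hab (W k w)).
  by move: Wk; rewrite ler_norml; split; lra.
have x_d : x < x + d by rewrite ltrDl.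
have d_x : x - d < x by rewrite gtrBl.
have [c1 [/andP[_ c1x] Wc1]] := near_h x (x + d) x_d.
have [c2 [/andP[c2x _] Wc2]] := near_h (x - d) x d_x.
have Pd (u v : R) : u - v = d -> normal_cdf u - normal_cdf v <= e / 2.
  move=> uv; rewrite (le_trans (ler_norm _))// (le_trans (PL _ _))// uv.
  by rewrite gtr0_norm// /d mulrC divfK// gt_eqF.
have := Pd (x + d) x; rewrite addrAC subrr add0r => /(_ erefl) P1.
have := Pd x (x - d); rewrite opprB addrCA subrr addr0 => /(_ erefl) P2.
near=> k.
have [h1 _] : avg (fun w => (W k w <= x)%R%:R : R) <= c1 + e / 2 /\
    c1 - e / 2 <= avg (fun w => (W k w <= x + d)%R%:R : R) by near: k.
have [_ h2] : avg (fun w => (W k w <= x - d)%R%:R : R) <= c2 + e / 2 /\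
    c2 - e / 2 <= avg (fun w => (W k w <= x)%R%:R : R) by near: k.
by rewrite ler_norml; apply/andP; split; lra.
Unshelve. all: by end_near. Qed.

(** * The degenerate kernel *)

Section Dot.
Context (R : realType) (F : finFieldType) (r : nat).
Local Notation V := 'rV[F]_r.

Definition dot (x y : V) : F := (x *m y^T) 0 0.

Lemma dotC x y : dot x y = dot y x.
Proof. by rewrite /dot -[x *m _]trmxK trmx_mul trmxK mxE. Qed.

Lemma dot0 x : dot 0 x = 0.
Proof. by rewrite /dot mul0mx mxE. Qed.

Lemma dotDr x y z : dot x (y + z) = dot x y + dot x z.
Proof. by rewrite /dot linearD mulmxDr mxE. Qed.

Lemma dotZr x a y : dot x (a *: y) = a * dot x y.
Proof. by rewrite /dot linearZ -scalemxAr mxE. Qed.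

(** Every column of the cokernel matrix of [x] is orthogonal to [x], and some column detects that
    [x'] lies outside the span of [x]. *)
Lemma exists_dot (x x' : V) : ~~ (x' <= x)%MS ->
  exists2 y, dot x y = 0 & dot x' y != 0.
Proof.
rewrite submxE => /rV0Pn[j xj]; exists (col j (cokermx x))^T.
  by rewrite /dot trmxK colE mulmxA -colE mulmx_coker !mxE.
by rewrite /dot trmxK colE mulmxA -colE mxE.
Qed.

Lemma card_rV_gt0 : (0 < #|{: V}|)%N.
Proof. by apply/card_gt0P; exists 0. Qed.

Lemma card_field_gt0 : (0 < #|F|)%N.
Proof. by apply/card_gt0P; exists 0. Qed.

(** Translation along [y0] leaves [Theta] unchanged and shifts [dot x y] by an arbitrary field
    element. Averaging over the shift shows that [dot x y] is uniform on [F] and independent of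
    [Theta]. *)
Lemma avg_dot_shift (Theta : V -> R) (phi : F -> R) (x y0 : V) :
  dot x y0 != 0 -> (forall y t, Theta (y + t *: y0) = Theta y) ->
  avg (fun y => Theta y * phi (dot x y)) = avg Theta * avg phi.
Proof.
move=> xy0 Th.
pose shift (t : F) (y : V) := y + (t / dot x y0) *: y0.
have bshift t : bijective (shift t).
  by exists (fun y => y - (t / dot x y0) *: y0) => y; rewrite /shift ?addrK ?subrK.
transitivity (avg (fun t : F => avg (fun y => Theta y * phi (dot x y + t)))).
  rewrite -[LHS](avg_cst (T := F)) ?card_field_gt0//; apply: eq_avg => t.
  rewrite -(avg_bij _ (bshift t)); apply: eq_avg => y /=.
  by rewrite /shift Th dotDr dotZr divfK.
rewrite exchange_avg -avgZr; apply: eq_avg => y.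
rewrite avgZ; congr (_ * _).
have badd : bijective (+%R (dot x y)).
  by exists (fun t => t - dot x y) => t; ring.
by rewrite -(avg_bij phi badd).
Qed.

Lemma avg_dot (phi : F -> R) (x : V) : x != 0 ->
  avg (fun y => phi (dot x y)) = avg phi.
Proof.
move=> x0; have [y0 _ xy0] : exists2 y, dot 0 y = 0 & dot x y != 0.
  apply: exists_dot; apply/negP => /sub_rVP[a] /eqP.
  by rewrite scaler0 (negPf x0).
have := @avg_dot_shift (fun=> 1) phi x y0 xy0 (fun _ _ => erefl).
rewrite avg_cst ?card_rV_gt0// mul1r => <-.
by apply: eq_avg => y; rewrite mul1r.
Qed.

Definition qinv : R := #|F|%:R ^- r.

Lemma qinv_gt0 : 0 < qinv.
Proof. by rewrite invr_gt0 exprn_gt0// ltr0n card_field_gt0. Qed.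

Lemma qinv_le1 : qinv <= 1.
Proof.
rewrite invf_le1 ?exprn_gt0 ?ltr0n ?card_field_gt0//.
by rewrite exprn_ege1// ler1n card_field_gt0.
Qed.

Lemma card_rVE : #|{: V}|%:R = qinv^-1 :> R.
Proof. by rewrite /qinv invrK card_mx mul1n natrX. Qed.

Lemma avg_is0 : avg (fun x : V => (x == 0)%:R : R) = qinv.
Proof.
rewrite /avg card_rVE invrK (bigD1 0)//= eqxx big1 ?addr0 ?mul1r// => x /negPf->//.
Qed.

Lemma avg_submx_le (x : V) :
  avg (fun x' : V => (x' <= x)%MS%:R : R) <= #|F|%:R * qinv.
Proof.
rewrite /avg card_rVE invrK ler_wpM2r ?(ltW qinv_gt0)//.
rewrite -natr_sum ler_nat.
have -> : (\sum_(y : V) (y <= x)%MS = #|[pred y : V | (y <= x)%MS]|)%N.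
  by rewrite -sum1_card [RHS]big_mkcond; apply: eq_bigr => y _ /=; rewrite inE; case: ifP.
apply: leq_trans (leq_imset_card (fun a => a *: x) F).
apply/subset_leq_card/fintype.subsetP => y; rewrite inE => /sub_rVP[a ->].
exact: imset_f.
Qed.

End Dot.

Section Kernel.
Context (R : realType) (F : finFieldType) (A : {set F}) (r : nat).
Local Notation V := 'rV[F]_r.
Local Notation rho := (@qinv R F r).
Local Notation gam := (gamma R A).

Definition dens : R := #|F|%:R^-1 * #|A|%:R.

Definition cind (c : F) : R := (c \in A)%:R - dens.

Definition edge (y : V) : R := gam * ((y == 0)%:R - rho).

(** The second summand cancels the row [x = 0], on which [dot x y] is constantly 0, so that each
    [bulk x] is centred in [y]. Before the [edge] correction, linearly independent vectors give
    exactly uncorrelated functions. *)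
Definition bulk (x y : V) : R := cind (dot x y) + gam * (x == 0)%:R.

(* The degenerate (second-order) Hoeffding projection of the indicator that
   the entry [dot x y] lies in [A]. *)
Definition kern (x y : V) : R := bulk x y + edge y.

Lemma gammaE : gam = - cind 0. Proof. by rewrite /gamma /cind opprB. Qed.

Lemma dens01 : 0 <= dens <= 1.
Proof.
rewrite /dens mulr_ge0 ?invr_ge0//= mulrC ler_pdivrMr ?ltr0n ?card_field_gt0//.
by rewrite mul1r ler_nat max_card.
Qed.

Lemma cind_le1 c : `|cind c| <= 1.
Proof.
have /andP[d0 d1] := dens01; rewrite /cind ler_norml.
by case: (c \in A); rewrite /=; apply/andP; split; lra.
Qed.

Lemma gamma_le1 : `|gam| <= 1. Proof. by rewrite gammaE normrN cind_le1. Qed.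

Lemma avg_in : avg (fun c => (c \in A)%:R : R) = dens.
Proof.
rewrite /avg /dens mulrC; congr (_ * _).
rewrite -natr_sum -sum1_card [in RHS]big_mkcond; congr (_%:R).
Qed.

Lemma avg_cind : avg cind = 0.
Proof. by rewrite avgB avg_in avg_cst ?subrr// card_field_gt0. Qed.

Lemma avg_cind_sqr : avg (fun c => cind c ^+ 2) = dens * (1 - dens).
Proof.
rewrite (eq_avg (h := fun c => (1 - 2 * dens) * (c \in A)%:R + dens ^+ 2)).
  by rewrite avgD avgZ avg_in avg_cst ?card_field_gt0//; ring.
by move=> c; rewrite /cind; case: (c \in A) => /=; ring.
Qed.

Lemma avg_edge : avg edge = 0.
Proof. by rewrite avgZ avgB avg_is0 avg_cst ?subrr ?mulr0 ?card_rV_gt0. Qed.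

Lemma edge_le1 y : `|edge y| <= 1.
Proof.
rewrite normrM mulr_ile1 ?gamma_le1// ler_norml.
have := qinv_gt0 R F r; have := qinv_le1 R F r.
by case: (y == 0) => /= h1 h2; apply/andP; split; lra.
Qed.

Lemma avg_norm_edge : avg (fun y => `|edge y|) <= 2 * rho.
Proof.
have r0 := qinv_gt0 R F r; have r1 := qinv_le1 R F r.
apply: (@le_trans _ _ (avg (fun y : V => (y == 0)%:R + rho))); last first.
  by rewrite avgD avg_is0 avg_cst ?card_rV_gt0//; lra.
apply: ler_avg => y; rewrite normrM (le_trans (ler_piMl _ gamma_le1))//.
by rewrite (le_trans (ler_normB _ _))// (gtr0_norm r0) ger0_norm.
Qed.

Lemma bulk0 y : bulk 0 y = 0.
Proof. by rewrite /bulk dot0 eqxx mulr1 gammaE subrr. Qed.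

Lemma bulkE x y : x != 0 -> bulk x y = cind (dot x y).
Proof. by move=> /negPf x0; rewrite /bulk x0 mulr0 addr0. Qed.

Lemma bulk_le1 x y : `|bulk x y| <= 1.
Proof.
have [->|x0] := eqVneq x 0; first by rewrite bulk0 normr0.
by rewrite bulkE ?cind_le1.
Qed.

Lemma kern_le2 x y : `|kern x y| <= 2.
Proof.
by rewrite (le_trans (ler_normD _ _))// -[2]/(1 + 1 : R) lerD ?bulk_le1 ?edge_le1.
Qed.

Lemma kernC x y : kern x y = kern y x.
Proof. by rewrite /kern /bulk /edge dotC; ring. Qed.

Lemma avg_bulk x : avg (bulk x) = 0.
Proof.
have [->|x0] := eqVneq x 0.
  by rewrite (eq_avg bulk0) avg_cst ?card_rV_gt0.
by rewrite (eq_avg (fun y => bulkE y x0)) avg_dot// avg_cind.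
Qed.

Lemma avg_kern x : avg (kern x) = 0.
Proof. by rewrite avgD avg_bulk avg_edge addr0. Qed.

Lemma avg_kern_l y : avg (kern^~ y) = 0.
Proof. by rewrite (eq_avg (fun x => kernC x y)) avg_kern. Qed.

Lemma avg_bulk_sqr x : x != 0 ->
  avg (fun y => bulk x y ^+ 2) = dens * (1 - dens).
Proof.
move=> x0; rewrite -avg_cind_sqr -(avg_dot _ x0); apply: eq_avg => y.
by rewrite bulkE.
Qed.

(** Along a direction orthogonal to [x] but not to [x'], [bulk x] is constant while [dot x' y] runs
    uniformly through [F], where [cind] has mean 0. *)
Lemma avg_bulk_indep x x' : ~~ (x' <= x)%MS ->
  avg (fun y => bulk x y * bulk x' y) = 0.
Proof.
move=> xx'; have x'0 : x' != 0.
  by apply: contraNneq xx' => ->; rewrite sub0mx.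
have [y0 xy0 x'y0] := exists_dot xx'.
have sh y t : bulk x (y + t *: y0) = bulk x y.
  by rewrite /bulk dotDr dotZr xy0 mulr0 addr0.
have := avg_dot_shift cind x'y0 sh; rewrite avg_cind mulr0 => <-.
by apply: eq_avg => y; rewrite [bulk x' y]bulkE.
Qed.

(** Pointwise the difference is at most [3 * |edge y|], and [|edge|] has mean at most [2 * rho]. *)
Lemma avg_kernM_bulk x x' :
  `|avg (fun y => kern x y * kern x' y) - avg (fun y => bulk x y * bulk x' y)|
  <= 6 * rho.
Proof.
rewrite -avgB (le_trans (ler_norm_avg _))//.
apply: (@le_trans _ _ (avg (fun y => 3 * `|edge y|))); last first.
  by rewrite avgZ; have := avg_norm_edge; lra.
apply: ler_avg => y; rewrite /kern.
have := bulk_le1 x y; have := bulk_le1 x' y; have := edge_le1 y.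
move: (bulk x y) (bulk x' y) (edge y) => u v e e1 v1 u1.
rewrite (_ : _ - _ = e * v + u * e + e * e); last by ring.
have h1 : `|e * v| <= `|e| by rewrite normrM ler_piMr.
have h2 : `|u * e| <= `|e| by rewrite normrM ler_piMl.
have h3 : `|e * e| <= `|e| by rewrite normrM ler_piMr.
apply: le_trans (ler_normD _ _) _.
by have := ler_normD (e * v) (u * e); lra.
Qed.

Section RowSums.
Context (m : nat).
Local Notation X := {ffun 'I_m -> V}.

Definition row_sum (w : X) (y : V) : R := \sum_i kern (w i) y.

Lemma avg_row_sum w : avg (row_sum w) = 0.
Proof. by rewrite avg_sum big1// => i _; exact: avg_kern. Qed.

(** With [y] fixed the average runs over the row vectors, so it is degeneracy in the first argument
    that centres the summands. [64 = 4 * 2 ^ 4], from the bound 2 on [kern]. *)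
Lemma avg_row_sum_pow4 (y : V) :
  avg (fun w => row_sum w y ^+ 4) <= 64 * m%:R ^+ 2.
Proof.
have := avg_sum_pow4 'I_m (card_rV_gt0 F r) (avg_kern_l y)
  (fun x => kern_le2 x y).
rewrite card_ord => /le_trans; apply.
by rewrite (_ : 4 * _ * _ = 64 * m%:R ^+ 2); last by ring.
Qed.

Lemma avg_row_sum_sqr_le :
  avg (fun w => avg (fun y => row_sum w y ^+ 2)) <= 4 * m%:R.
Proof.
rewrite exchange_avg; apply: avg_le_cst => [|y]; first by rewrite mulr_ge0.
have -> : avg (fun w => row_sum w y ^+ 2) = _ :=
  avg_sum_sqr 'I_m (card_rV_gt0 F r) (avg_kern_l y).
rewrite card_ord mulrC ler_wpM2r//; apply: avg_le_cst => // x.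
rewrite -real_normK ?num_real// (_ : 4 = 2 ^+ 2) ?lerXn2r ?nnegrE ?kern_le2//.
by rewrite -natrX.
Qed.

(** Expand the square. A diagonal term is within [6 * rho] of [dens * (1 - dens)] unless [w i = 0];
    an off-diagonal one is at most [6 * rho] unless [w j] lies in the span of [w i], an event of
    probability at most [q * rho]. *)
Lemma avg_row_variance :
  avg (fun w : X => `|avg (fun y => row_sum w y ^+ 2) - m%:R * (dens * (1 - dens))|)
  <= m%:R * (7 * rho) + m%:R ^+ 2 * ((6 + #|F|%:R) * rho).
Proof.
have r0 := qinv_gt0 R F r; have /andP[d0 d1] := dens01.
have V0 := card_rV_gt0 F r.
have X0 : (0 < #|{: X}|)%N by exact: card_ffun_gt0.
set s := dens * (1 - dens).
have diag x : `|avg (fun y => kern x y * kern x y) - s| <= 6 * rho + (x == 0)%:R.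
  have := avg_kernM_bulk x x; have [->|x0] := eqVneq x 0.
    rewrite (eq_avg (g := fun y => bulk 0 y * bulk 0 y) (h := fun=> 0)); last first.
      by move=> y; rewrite bulk0 mulr0.
    rewrite avg_cst// subr0 => h; apply: (le_trans (ler_normB _ _)).
    rewrite lerD// /s ger0_norm ?mulr_ge0 ?subr_ge0// mulr_ile1 ?subr_ge0//.
    by rewrite gerBl.
  rewrite (eq_avg (g := fun y => bulk x y * bulk x y) (h := fun y => bulk x y ^+ 2))//.
  by rewrite avg_bulk_sqr// addr0.
have off x x' : `|avg (fun y => kern x y * kern x' y)| <= 6 * rho + (x' <= x)%MS%:R.
  have := avg_kernM_bulk x x'; have [xx'|xx'] := boolP (x' <= x)%MS; last first.
    by rewrite avg_bulk_indep// subr0 addr0.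
  move=> h; rewrite -[X in `|X|](subrK (avg (fun y => bulk x y * bulk x' y))).
  rewrite (le_trans (ler_normD _ _))// lerD// (le_trans (ler_norm_avg _))//.
  apply: avg_le_cst => // y; rewrite normrM mulr_ile1 ?bulk_le1//.
apply: (@le_trans _ _ (avg (fun w : X => \sum_i ((6 * rho + (w i == 0)%:R) +
   \sum_(j | j != i) (6 * rho + (w j <= w i)%MS%:R))))).
  apply: ler_avg => w.
  have -> : avg (fun y => row_sum w y ^+ 2) - m%:R * s =
    \sum_i ((avg (fun y => kern (w i) y * kern (w i) y) - s) +
    \sum_(j | j != i) avg (fun y => kern (w i) y * kern (w j) y)).
    transitivity (\sum_i \sum_j avg (fun y => kern (w i) y * kern (w j) y) - m%:R * s).
      congr (_ - _); under [RHS]eq_bigr => i _ do rewrite -avg_sum.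
      rewrite -avg_sum; apply: eq_avg => y; rewrite /row_sum expr2 mulr_suml.
      by apply: eq_bigr => i _; rewrite mulr_sumr.
    rewrite big_split sumrB /= sumr_const card_ord -[s *+ m]mulr_natl.
    rewrite addrAC; congr (_ - _); rewrite -big_split /=.
    by apply: eq_bigr => i _; rewrite (bigD1 i).
  rewrite (le_trans (ler_norm_sum _ _ _))//; apply: ler_sum => i _.
  rewrite (le_trans (ler_normD _ _))// lerD//.
  by rewrite (le_trans (ler_norm_sum _ _ _))//; apply: ler_sum.
rewrite avg_sum.
apply: (@le_trans _ _ (\sum_(i < m) (7 * rho + m%:R * ((6 + #|F|%:R) * rho)))); last first.
  rewrite sumr_const card_ord -[leLHS]mulr_natl mulrDr lerD2l.
  by rewrite expr2 -[leRHS]mulrA.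
apply: ler_sum => i _; rewrite avgD lerD//.
  rewrite avgD avg_cst// (avg_coord V0 i (fun x => (x == 0)%:R)).
  by rewrite avg_is0; lra.
rewrite avg_sum (le_trans (y := \sum_(j < m | j != i) ((6 + #|F|%:R) * rho)))//.
  apply: ler_sum => j ji; rewrite avgD avg_cst// [leRHS]mulrDl lerD2l.
  rewrite (avg_resample V0 j); apply: avg_le_cst => [|w].
    by rewrite mulr_ge0// ltW.
  apply: le_trans (avg_submx_le R (w i)); apply: ler_avg => x.
  by rewrite !ffunE eqxx eq_sym (negPf ji).
rewrite sumr_const -[leLHS]mulr_natl ler_wpM2r//.
  by rewrite mulr_ge0 ?addr_ge0// ltW.
by rewrite ler_nat (leq_trans (max_card _))// card_ord.
Qed.

End RowSums.
End Kernel.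

(** * Normal approximation for products of independent factors *)

Section StandardizedCount.
Context (R : realType) (F : finFieldType) (A : {set F}) (m n r : nat).
Local Notation V := 'rV[F]_r.
Local Notation rho := (@qinv R F r).
Local Notation gam := (gamma R A).
Local Notation p := (dens R A).
Local Notation X := {ffun 'I_m -> V}.
Local Notation Z := {ffun 'I_n -> V}.
Local Notation M := (m%:R : R).
Local Notation N := (n%:R : R).
Local Notation S := (sigma2 R A m n r).
Local Notation s0 := (p * (1 - p)).

Definition prod_mx (w : X) (z : Z) : dmatrix F m n :=
  \matrix_(i, j) dot (w i) (z j).

Lemma ct_prod_mx w z : (ct A (prod_mx w z))%:R - mu R A m n r =
  \sum_j row_sum R A w (z j) -
  (\sum_i N * edge R A (w i) + \sum_j M * edge R A (z j)).
Proof.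
have -> : (ct A (prod_mx w z))%:R = \sum_i \sum_j (dot (w i) (z j) \in A)%:R :> R.
  rewrite /ct -sum1_card big_mkcond /= natr_sum pair_bigA /=.
  by apply: eq_bigr => -[i j] _; rewrite inE mxE /=; case: (_ \in _).
rewrite exchange_big.
have -> : mu R A m n r = \sum_(j < n) \sum_(i < m) (p - rho * gam).
  rewrite /mu !sumr_const !card_ord -[in RHS]mulrnA -[RHS]mulr_natl mulnC.
  by rewrite /dens.
have -> : \sum_i N * edge R A (w i) = \sum_(j < n) \sum_i edge R A (w i).
  by rewrite sumr_const card_ord -mulr_sumr mulr_natl.
rewrite -big_split -!sumrB /=; apply: eq_bigr => j _.
rewrite /row_sum -sumrB.
have -> : M * edge R A (z j) = \sum_(i < m) edge R A (z j).
  by rewrite sumr_const card_ord mulr_natl.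
rewrite -big_split -sumrB /=; apply: eq_bigr => i _.
by rewrite /kern /bulk /edge /cind; ring.
Qed.

Lemma avg_edge_sqr : avg (fun y : V => edge R A y ^+ 2) = gam ^+ 2 * (rho * (1 - rho)).
Proof.
rewrite (eq_avg (h := fun y : V => gam ^+ 2 * ((1 - 2 * rho) * (y == 0)%:R + rho ^+ 2))).
  by rewrite avgZ avgD avgZ avg_is0 avg_cst ?card_rV_gt0//; ring.
by move=> y; rewrite /edge; case: (y == 0) => /=; ring.
Qed.

Lemma avg_edge_pow4 : avg (fun y : V => edge R A y ^+ 4) <= gam ^+ 4 * rho.
Proof.
have r0 := qinv_gt0 R F r; have r1 := qinv_le1 R F r.
apply: (@le_trans _ _ (avg (fun y : V => gam ^+ 2 * edge R A y ^+ 2))); last first.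
  rewrite avgZ avg_edge_sqr [leLHS](_ : _ = gam ^+ 4 * (rho * (1 - rho))); last by ring.
  rewrite ler_wpM2l ?exprn_even_ge0//.
  by rewrite ler_piMr ?(ltW r0)// lerBlDr lerDl ltW.
apply: ler_avg => y; rewrite (exprD _ 2 2) ler_wpM2r ?sqr_ge0//.
rewrite /edge exprMn ler_piMr ?sqr_ge0// -real_normK ?num_real// expr_le1//.
by rewrite ler_norml; case: (y == 0) => /=; apply/andP; split; lra.
Qed.

Local Notation vv := ((p - rho * gam) * (1 - (p - rho * gam))).

Lemma sigma2E : S = M * N * vv + M * N * (M + N - 2) * (rho * (1 - rho)) * gam ^+ 2.
Proof. by rewrite /sigma2 natrM -/p -/rho; ring. Qed.

(** [p - rho * gam] is the probability that one entry lies in [A]: the entry is 0 if the row vector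
    vanishes and uniform otherwise. *)
Lemma entry_prob01 : 0 <= p - rho * gam <= 1.
Proof.
have r0 := qinv_gt0 R F r; have r1 := qinv_le1 R F r.
have /andP[p0 p1] := dens01 R A.
have -> : p - rho * gam = (1 - rho) * p + rho * (0 \in A)%:R.
  by rewrite /gamma -/p; ring.
have h : 0 <= ((0 \in A)%:R : R) <= 1 by case: (_ \in _) => /=; rewrite ?lexx ler01.
by case/andP: h; set c := (_ \in _)%:R => c0 c1; apply/andP; split; nra.
Qed.

Lemma entry_var01 : 0 <= vv <= 1.
Proof.
have /andP[h0 h1] := entry_prob01; move: (p - rho * gam) h0 h1 => x h0 h1.
by apply/andP; split; nra.
Qed.

Lemma gamma_sqr_le1 : gam ^+ 2 <= 1.
Proof. by rewrite -real_normK ?num_real// expr_le1// gamma_le1. Qed.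

Definition std_prod (wz : X * Z) : R := std_ct R A r (prod_mx wz.1 wz.2).

Lemma std_prodE wz : std_prod wz =
  \sum_j (row_sum R A wz.1 (wz.2 j) / Num.sqrt S) +
  (\sum_i (- N / Num.sqrt S * edge R A (wz.1 i)) +
   \sum_j (- M / Num.sqrt S * edge R A (wz.2 j))).
Proof.
rewrite /std_prod /std_ct ct_prod_mx -!mulr_suml -!mulr_sumr; ring.
Qed.

Context (K : R) (f f' : R -> R) (eta : R).
Hypothesis ff' : stein_class K f f'.
Hypothesis eta01 : 0 < eta <= 1.

Let V0 : (0 < #|{: V}|)%N := card_rV_gt0 F r.
Let X0 : (0 < #|{: X}|)%N := card_ffun_gt0 _ V0.
Let Z0 : (0 < #|{: Z}|)%N := card_ffun_gt0 _ V0.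
Let XZ0 : (0 < #|{: X * Z}|)%N. Proof. by rewrite card_prod muln_gt0 X0 Z0. Qed.

Let bulk_part (wz : X * Z) := \sum_j (row_sum R A wz.1 (wz.2 j) / Num.sqrt S).
Let edge_part (wz : X * Z) := \sum_i (- N / Num.sqrt S * edge R A (wz.1 i)) +
   \sum_j (- M / Num.sqrt S * edge R A (wz.2 j)).

Section Scaled.
Hypothesis S0 : 0 < S.

Let sq2 : Num.sqrt S ^+ 2 = S. Proof. by rewrite sqr_sqrtr ?ltW. Qed.
Let sq4 : Num.sqrt S ^+ 4 = S ^+ 2. Proof. by rewrite (exprM _ 2 2) sq2. Qed.

Let row_sumV_sqr (w : X) (y : V) :
  (row_sum R A w y / Num.sqrt S) ^+ 2 = row_sum R A w y ^+ 2 / S.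
Proof. by rewrite exprMn exprVn sq2. Qed.

Let row_sumV_pow4 (w : X) (y : V) :
  (row_sum R A w y / Num.sqrt S) ^+ 4 = row_sum R A w y ^+ 4 / S ^+ 2.
Proof. by rewrite exprMn exprVn sq4. Qed.

Let avg_edgeZ_sqr a : avg (fun y : V => (- a / Num.sqrt S * edge R A y) ^+ 2) =
  a ^+ 2 * (gam ^+ 2 * (rho * (1 - rho))) / S.
Proof.
rewrite (eq_avg (h := fun y : V => a ^+ 2 / S * edge R A y ^+ 2)).
  by rewrite avgZ avg_edge_sqr mulrAC.
by move=> y; rewrite !exprMn exprVn sq2 sqrrN.
Qed.

Let avg_edgeZ_pow4 a : avg (fun y : V => (- a / Num.sqrt S * edge R A y) ^+ 4) <=
  a ^+ 4 * (gam ^+ 4 * rho) / S ^+ 2.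
Proof.
rewrite (eq_avg (h := fun y : V => a ^+ 4 / S ^+ 2 * edge R A y ^+ 4)).
  rewrite avgZ [leRHS]mulrAC ler_wpM2l ?avg_edge_pow4//.
  by rewrite divr_ge0 ?sqr_ge0// exprn_even_ge0.
by move=> y; rewrite !exprMn exprVn sq4 (exprM _ 2 2) sqrrN -exprM.
Qed.

Let avg_edgeZ a : avg (fun y : V => - a / Num.sqrt S * edge R A y) = 0.
Proof. by rewrite avgZ avg_edge mulr0. Qed.

Let avg_edge_part_sqr : avg (fun wz => edge_part wz ^+ 2) =
  M * N * (M + N) * (gam ^+ 2 * (rho * (1 - rho))) / S.
Proof.
have [E _] := stein_two_sums ff' 'I_m 'I_n V0 (avg_edgeZ N) (avg_edgeZ M) ltr01.
transitivity (M * (N ^+ 2 * (gam ^+ 2 * (rho * (1 - rho))) / S) +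
  N * (M ^+ 2 * (gam ^+ 2 * (rho * (1 - rho))) / S)); last by ring.
rewrite -!avg_edgeZ_sqr; move: E; rewrite /= !card_ord => <-.
by rewrite -avg_pair.
Qed.

(** The edge part is the perturbation. The three hypotheses are the conditions of [stein_combine] on
    [d], [k] and [e], cleared of the denominators [S] and [S ^ 2]. *)
Lemma stein_bulk :
  let d := avg (fun w : X => `|N * avg (fun y => row_sum R A w y ^+ 2) - S|) in
  d <= eta ^+ 2 * S -> 64 * M ^+ 2 * N <= eta ^+ 2 * S ^+ 2 ->
  M * N * (M + N) * (gam ^+ 2 * (rho * (1 - rho))) <= eta ^+ 2 * S ->
  `|avg (fun wz => f' (std_prod wz) - std_prod wz * f (std_prod wz))| <= K * (9 * eta).
Proof.
move=> d dS kS eS; have /andP[eta0 eta1] := eta01.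
rewrite (eq_avg (h := fun wz => f' (bulk_part wz + edge_part wz) -
  (bulk_part wz + edge_part wz) * f (bulk_part wz + edge_part wz))); last first.
  by move=> wz; rewrite std_prodE.
have xi0 (w : X) : avg (fun y => row_sum R A w y / Num.sqrt S) = 0.
  by rewrite avgZr avg_row_sum mul0r.
have [V2 H] := stein_conditional ff' 'I_n V0 X0 xi0 eta0.
move: V2 H; rewrite /= card_ord -(avg_pair (fun (w : X) (z : Z) =>
  (\sum_j (row_sum R A w (z j) / Num.sqrt S)) ^+ 2)).
rewrite -(avg_pair (fun (w : X) (z : Z) =>
   f' (\sum_j (row_sum R A w (z j) / Num.sqrt S)) -
   (\sum_j (row_sum R A w (z j) / Num.sqrt S)) *
   f (\sum_j (row_sum R A w (z j) / Num.sqrt S)))).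
set d1 := avg (fun w => `|_ - 1|); set k := N * avg _ => V2 H.
have d1E : d1 = d / S.
  rewrite /d -avgZr; apply: eq_avg => w.
  rewrite (eq_avg (row_sumV_sqr w)) avgZr -[X in _ = _ / X](gtr0_norm S0) -normf_div.
  by rewrite mulrBl mulrA divff ?gt_eqF.
apply: (stein_combine ff' XZ0 eta01 _ _ _ V2 _ H).
- have d0 : 0 <= d by rewrite /d; apply: avg_ge0 => w.
  by rewrite d1E divr_ge0 ?(ltW S0)//= ler_pdivrMr.
(* The fourth moment is bounded for each fixed [y], so the row vectors have to be averaged first. *)
- rewrite /k exchange_avg.
  rewrite (eq_avg (h := fun y => avg (fun w : X => row_sum R A w y ^+ 4) / S ^+ 2)).
    rewrite avgZr mulrA ler_pdivrMr ?exprn_gt0//; apply: le_trans kS.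
    rewrite mulrC ler_wpM2r//; apply: avg_le_cst => [|y].
      by rewrite mulr_ge0// sqr_ge0.
    exact: avg_row_sum_pow4.
  by move=> y; rewrite -avgZr; apply: eq_avg => w.
- exact: lexx.
- by rewrite avg_edge_part_sqr ler_pdivrMr.
Qed.

(** The roles are exchanged: the edge part consists of two independent i.i.d. sums, and the bulk
    part is a perturbation of second moment at most [4 * M * N / S]. *)
Lemma stein_edge :
  `|M * N * (M + N) * (gam ^+ 2 * (rho * (1 - rho))) - S| <= eta ^+ 2 * S ->
  M * N * (M ^+ 3 + N ^+ 3) * (gam ^+ 4 * rho) <= eta ^+ 2 * S ^+ 2 ->
  4 * (M * N) <= eta ^+ 2 * S ->
  `|avg (fun wz => f' (std_prod wz) - std_prod wz * f (std_prod wz))| <= K * (9 * eta).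
Proof.
move=> dS kS eS; have /andP[eta0 eta1] := eta01.
rewrite (eq_avg (h := fun wz => f' (edge_part wz + bulk_part wz) -
  (edge_part wz + bulk_part wz) * f (edge_part wz + bulk_part wz))); last first.
  move=> wz; have -> : std_prod wz = edge_part wz + bulk_part wz.
    by rewrite std_prodE addrC.
  by [].
have [V2 H] := stein_two_sums ff' 'I_m 'I_n V0 (avg_edgeZ N) (avg_edgeZ M) eta0.
move: V2 H; rewrite /= !card_ord -(avg_pair (fun (w : X) (z : Z) =>
  (\sum_i (- N / Num.sqrt S * edge R A (w i)) +
   \sum_j (- M / Num.sqrt S * edge R A (z j))) ^+ 2)).
rewrite -(avg_pair (fun (w : X) (z : Z) => f' (edge_part (w, z)) -
  edge_part (w, z) * f (edge_part (w, z)))).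
set v := M * _ + _; set k := M * _ + _ => V2 H.
have vE : v = M * N * (M + N) * (gam ^+ 2 * (rho * (1 - rho))) / S.
  by rewrite /v !avg_edgeZ_sqr; ring.
apply: (stein_combine ff' XZ0 eta01 _ _ _ _ _ H).
- have -> : v - 1 = (M * N * (M + N) * (gam ^+ 2 * (rho * (1 - rho))) - S) / S.
    by rewrite mulrBl divff ?lt0r_neq0// vE.
  by rewrite normr_ge0 /= normrM normfV (gtr0_norm S0) ler_pdivrMr.
- apply: (@le_trans _ _ (M * (N ^+ 4 * (gam ^+ 4 * rho) / S ^+ 2) +
    N * (M ^+ 4 * (gam ^+ 4 * rho) / S ^+ 2))).
    by rewrite lerD// ler_wpM2l.
  rewrite [leLHS](_ : _ = M * N * (M ^+ 3 + N ^+ 3) * (gam ^+ 4 * rho) / S ^+ 2).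
    by rewrite ler_pdivrMr ?exprn_gt0.
  by ring.
- exact: lexx.
- by rewrite V2; have := ler_norm (v - 1); lra.
- rewrite /bulk_part (avg_pair (fun (w : X) (z : Z) =>
    (\sum_j (row_sum R A w (z j) / Num.sqrt S)) ^+ 2)).
  rewrite (eq_avg (h := fun w : X => N / S * avg (fun y => row_sum R A w y ^+ 2))).
    rewrite avgZ mulrAC ler_pdivrMr//; apply: le_trans eS.
    by rewrite mulrA [leRHS]mulrC ler_wpM2l// avg_row_sum_sqr_le.
  move=> w; have xi0 : avg (fun y => row_sum R A w y / Num.sqrt S) = 0.
    by rewrite avgZr avg_row_sum mul0r.
  have -> := avg_sum_sqr 'I_n V0 xi0; rewrite card_ord.
  by rewrite (eq_avg (row_sumV_sqr w)) avgZr mulrA mulrAC.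
Qed.

End Scaled.

Section Regimes.
Hypotheses (m_gt0 : (0 < m)%N) (n_gt0 : (0 < n)%N).

Let M_ge1 : 1 <= M. Proof. by rewrite ler1n. Qed.
Let N_ge1 : 1 <= N. Proof. by rewrite ler1n. Qed.

Let rho_var : 0 <= rho * (1 - rho) <= rho.
Proof.
have r0 := qinv_gt0 R F r; have r1 := qinv_le1 R F r.
by rewrite mulr_ge0 ?(ltW r0) ?subr_ge0//= ler_piMr ?(ltW r0)// gerBl ltW.
Qed.

(** The variance of one entry differs from [s0] by at most [2 * rho], which exactly makes up for the
    [- 2] in [M + N - 2]. *)
Lemma sigma2_near_bulk : `|S - M * N * s0| <= M * N * ((M + N) * rho).
Proof.
have M1 := M_ge1; have N1 := N_ge1.
have r0 := qinv_gt0 R F r; have r1 := qinv_le1 R F r.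
have g1 := gamma_sqr_le1; have /andP[p0 p1] := dens01 R A.
have -> : S - M * N * s0 = M * N * (rho * (gam * (2 * p - 1) - rho * gam ^+ 2) +
    (M + N - 2) * (rho * (1 - rho) * gam ^+ 2)).
  by rewrite sigma2E; ring.
rewrite normrM [`|M * N|]ger0_norm ?mulr_ge0// ler_wpM2l ?mulr_ge0//.
have h1 : `|rho * (gam * (2 * p - 1) - rho * gam ^+ 2)| <= 2 * rho.
  rewrite normrM (gtr0_norm r0) mulrC ler_wpM2r ?(ltW r0)//.
  rewrite (le_trans (ler_normB _ _))// -[2]/(1 + 1 : R) lerD//.
    by rewrite normrM mulr_ile1 ?gamma_le1// ler_norml; apply/andP; split; lra.
  by rewrite (ger0_norm (mulr_ge0 (ltW r0) (sqr_ge0 _))) (mulr_ile1 (ltW r0) (sqr_ge0 _)).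
have h2 : `|(M + N - 2) * (rho * (1 - rho) * gam ^+ 2)| <= (M + N - 2) * rho.
  have MN2 : 0 <= M + N - 2 by lra.
  have /andP[r2 r3] := rho_var.
  rewrite (ger0_norm (mulr_ge0 MN2 (mulr_ge0 r2 (sqr_ge0 _)))) ler_wpM2l//.
  by rewrite (le_trans (ler_piMr r2 g1)).
apply: le_trans (ler_normD _ _) _.
by apply: le_trans (lerD h1 h2) _; lra.
Qed.

(** The first hypothesis gives [S >= M * N * s0 / 2], whence its factor 2. [15 + q] covers 7 from
    the diagonal, [6 + q] from the off-diagonal terms and 1 from comparing [S] with [M * N * s0].
    [256 = 64 * 4] turns the fourth-moment condition into one on [N]. *)
Lemma stein_bulk_regime : 0 < s0 ->
  2 * (15 + #|F|%:R) * ((M + N) * rho) <= s0 * eta ^+ 2 ->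
  256 <= N * s0 ^+ 2 * eta ^+ 2 ->
  `|avg (fun wz => f' (std_prod wz) - std_prod wz * f (std_prod wz))| <= K * (9 * eta).
Proof.
move=> s00 hx hN; have /andP[eta0 eta1] := eta01.
have M1 := M_ge1; have N1 := N_ge1.
have r0 := qinv_gt0 R F r; have r1 := qinv_le1 R F r.
have g1 := gamma_sqr_le1.
have hS := sigma2_near_bulk; set x := (M + N) * rho in hx hS.
have q0 : 0 <= #|F|%:R :> R by [].
have MN0 : 0 < M * N by rewrite mulr_gt0 ?ltr0n.
have x0 : 0 < x by rewrite mulr_gt0// addr_gt0 ?ltr0n.
have eta2 : eta ^+ 2 <= 1 by rewrite expr_le1// ltW.
have e20 : 0 < eta ^+ 2 by rewrite exprn_gt0.
have qx : 0 <= #|F|%:R * x by rewrite mulr_ge0// ltW.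
have xs : 30 * x <= s0.
  have : s0 * eta ^+ 2 <= s0 by rewrite ler_piMr// ltW.
  lra.
have Sh : M * N * (s0 / 2) <= S.
  have : M * N * x <= M * N * (s0 / 2) by rewrite ler_wpM2l ?(ltW MN0)//; lra.
  by move: hS; rewrite ler_norml => /andP[+ _]; lra.
have S0 : 0 < S by rewrite (lt_le_trans _ Sh)// mulr_gt0// divr_gt0.
have eS : M * N * ((15 + #|F|%:R) * x) <= eta ^+ 2 * S.
  apply: (@le_trans _ _ (eta ^+ 2 * (M * N * (s0 / 2)))).
    by rewrite [leRHS]mulrCA ler_wpM2l ?(ltW MN0)//; lra.
  by rewrite ler_wpM2l ?(ltW e20).
apply: (stein_bulk S0).
- apply: le_trans eS.
  apply: (@le_trans _ _ (avg (fun w : X =>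
     N * `|avg (fun y => row_sum R A w y ^+ 2) - M * s0| + M * N * x))).
    apply: ler_avg => w; rewrite (_ : _ - S = N * (avg (fun y => row_sum R A w y ^+ 2) - M * s0)
      - (S - M * N * s0)); last by ring.
    by rewrite (le_trans (ler_normB _ _))// lerD// normrM ger0_norm.
  rewrite avgD avgZ avg_cst//.
  apply: (@le_trans _ _ (N * (M * (7 * rho) + M ^+ 2 * ((6 + #|F|%:R) * rho)) + M * N * x)).
    by rewrite lerD2r ler_wpM2l// avg_row_variance.
  rewrite (_ : _ + _ = M * N * (7 * rho + (6 + #|F|%:R) * (M * rho) + x)); last by ring.
  rewrite ler_wpM2l ?(ltW MN0)//.
  have h1 : rho <= x by rewrite ler_peMl ?(ltW r0)//; lra.
  have h2 : (6 + #|F|%:R) * (M * rho) <= (6 + #|F|%:R) * x.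
    rewrite ler_wpM2l ?addr_ge0// ler_wpM2r ?(ltW r0)//; lra.
  lra.
- apply: (@le_trans _ _ (eta ^+ 2 * (M * N * (s0 / 2)) ^+ 2)); last first.
    rewrite ler_wpM2l ?(ltW e20)// lerXn2r ?nnegrE// ?(ltW S0)//.
    by rewrite mulr_ge0 ?(ltW MN0)// divr_ge0 ?(ltW s00).
  rewrite [leLHS](_ : _ = M ^+ 2 * N * (256 / 4)); last by field.
  rewrite [leRHS](_ : _ = M ^+ 2 * N * (N * s0 ^+ 2 * eta ^+ 2 / 4)); last by field.
  by rewrite ler_wpM2l ?mulr_ge0 ?sqr_ge0// ler_wpM2r ?invr_ge0.
- apply: le_trans eS; rewrite -mulrA ler_wpM2l ?(ltW MN0)//.
  apply: (@le_trans _ _ x); last by lra.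
  rewrite ler_wpM2l ?addr_ge0//.
  have /andP[r2 r3] := rho_var.
  by rewrite (le_trans (ler_piMl r2 g1)).
Qed.

(** [theta] bounds from below the expected numbers [M * rho] and [N * rho] of zero vectors on the
    two sides. When it is large, the [gam ^+ 2] term dominates [S]; [rho <= 1 / 2] keeps the factor
    [1 - rho] in that term away from 0. *)
Lemma stein_edge_regime (theta : R) : rho <= 1 / 2 ->
  theta <= M * rho -> theta <= N * rho ->
  32 <= theta * gam ^+ 2 * eta ^+ 2 ->
  `|avg (fun wz => f' (std_prod wz) - std_prod wz * f (std_prod wz))| <= K * (9 * eta).
Proof.
move=> rh tM tN th; have /andP[eta0 eta1] := eta01.
have M1 := M_ge1; have N1 := N_ge1.
have r0 := qinv_gt0 R F r; have r1 := qinv_le1 R F r.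
have g1 := gamma_sqr_le1; have g0 : 0 <= gam ^+ 2 by rewrite sqr_ge0.
have e21 : eta ^+ 2 <= 1 by rewrite expr_le1// ltW.
have e20 : 0 < eta ^+ 2 by rewrite exprn_gt0.
have MN0 : 0 < M * N by rewrite mulr_gt0 ?ltr0n.
have t0 : 0 < theta.
  rewrite ltNge; apply/negP => t0.
  have : theta * (gam ^+ 2 * eta ^+ 2) <= 0.
    by rewrite mulr_le0_ge0// mulr_ge0// ltW.
  by rewrite mulrA; lra.
have te : 32 <= theta * eta ^+ 2.
  apply: le_trans th _; rewrite ler_wpM2r ?(ltW e20)//.
  by rewrite ler_piMr ?(ltW t0).
have t32 : 32 <= theta by apply: le_trans te _; rewrite ler_piMr ?(ltW t0).
have M32 : 32 <= M by rewrite (le_trans t32)// (le_trans tM)// ler_piMr.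
have N32 : 32 <= N by rewrite (le_trans t32)// (le_trans tN)// ler_piMr.
have rr : rho / 2 <= rho * (1 - rho) by rewrite ler_wpM2l ?(ltW r0)//; lra.
have /andP[v0 v1] := entry_var01.
have Sh : M * N * ((M + N) * rho * gam ^+ 2 / 4) <= S.
  rewrite sigma2E -[leLHS]add0r lerD//; first by rewrite mulr_ge0// ltW.
  rewrite [leRHS](_ : _ = M * N * ((M + N - 2) * (rho * (1 - rho) * gam ^+ 2)));
    last by ring.
  rewrite ler_wpM2l ?(ltW MN0)//.
  rewrite [leLHS](_ : _ = ((M + N) / 2) * (rho / 2 * gam ^+ 2)); last by field.
  have h1 : 0 <= (M + N) / 2 by lra.
  have h2 : 0 <= rho / 2 * gam ^+ 2 by rewrite mulr_ge0//; lra.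
  have h3 : (M + N) / 2 <= M + N - 2 by lra.
  by rewrite (ler_pM h1 h2 h3)// ler_wpM2r.
have S16 : 16 * (M * N) <= eta ^+ 2 * S.
  apply: (@le_trans _ _ (eta ^+ 2 * (M * N * ((M + N) * rho * gam ^+ 2 / 4)))); last first.
    by rewrite ler_wpM2l ?(ltW e20).
  rewrite [leRHS]mulrCA [leLHS]mulrC ler_wpM2l ?(ltW MN0)//.
  have : 2 * theta * (gam ^+ 2 * eta ^+ 2) <= (M + N) * rho * (gam ^+ 2 * eta ^+ 2).
    by rewrite (ler_wpM2r (mulr_ge0 g0 (ltW e20)))// mulrDl; lra.
  move: th; set u := gam ^+ 2; set e2 := eta ^+ 2.
  have -> : e2 * ((M + N) * rho * u / 4) = (M + N) * rho * (u * e2) / 4 by ring.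
  by rewrite -mulrA; lra.
have S0 : 0 < S.
  have : 0 < eta ^+ 2 * S by rewrite (lt_le_trans _ S16)// mulr_gt0.
  by rewrite pmulr_rgt0.
have /andP[r2 r3] := rho_var.
apply: (stein_edge S0).
- apply: le_trans S16.
  rewrite sigma2E (_ : _ - _ = M * N * (2 * (gam ^+ 2 * (rho * (1 - rho))) - vv)); last by ring.
  rewrite normrM (gtr0_norm MN0) [leRHS]mulrC ler_wpM2l ?(ltW MN0)//.
  have : 0 <= gam ^+ 2 * (rho * (1 - rho)) <= 1.
    by rewrite mulr_ge0//= mulr_ile1// (le_trans r3).
  move: (vv) v0 v1 (gam ^+ 2 * _) => a a0 a1 b /andP[b0 b1].
  by rewrite ler_norml; apply/andP; split; lra.
- apply: (@le_trans _ _ (eta ^+ 2 * (M * N * ((M + N) * rho * gam ^+ 2 / 4)) ^+ 2)); last first.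
    rewrite ler_wpM2l ?(ltW e20)// lerXn2r ?nnegrE// ?(ltW S0)//.
    by rewrite mulr_ge0 ?(ltW MN0)// divr_ge0// mulr_ge0// mulr_ge0 ?addr_ge0// ltW.
  rewrite [leRHS](_ : _ = M * N * (gam ^+ 4 * rho) *
    ((M + N) ^+ 2 * (M * N * rho * eta ^+ 2 / 16))); last by field.
  rewrite mulrAC ler_wpM2l//.
    by rewrite mulr_ge0 ?(ltW MN0)// mulr_ge0 ?(ltW r0)// exprn_even_ge0.
  apply: (@le_trans _ _ ((M + N) ^+ 2 * (M + N))).
    rewrite (_ : (M + N) ^+ 2 * (M + N) = M ^+ 3 + N ^+ 3 +
      (3 * M ^+ 2 * N + 3 * M * N ^+ 2)); last by ring.
    by rewrite lerDl addr_ge0 ?mulr_ge0 ?sqr_ge0.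
  rewrite ler_wpM2l ?sqr_ge0// ler_pdivlMr//.
  have h1 : M * 32 <= M * (N * rho * eta ^+ 2).
    by rewrite ler_wpM2l// (le_trans te)// ler_wpM2r ?(ltW e20).
  have h2 : N * 32 <= N * (M * rho * eta ^+ 2).
    by rewrite ler_wpM2l// (le_trans te)// ler_wpM2r ?(ltW e20).
  move: h1 h2; have -> : M * (N * rho * eta ^+ 2) = M * N * rho * eta ^+ 2 by ring.
  have -> : N * (M * rho * eta ^+ 2) = M * N * rho * eta ^+ 2 by ring.
  by move: (M * N * _ * _) => a; lra.
- apply: le_trans S16; lra.
Qed.

End Regimes.

End StandardizedCount.

(** * Conditioning on the rank *)

Section RankTransfer.
Context (R : realType) (F : finFieldType) (r : nat).
Local Notation q := (#|F|%:R : R).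

Definition mx_of_cols k (z : {ffun 'I_k -> 'rV[F]_r}) : 'M[F]_(r, k) :=
  \matrix_(a, j) z j 0 a.

Lemma mx_of_cols_bij k : bijective (@mx_of_cols k).
Proof.
exists (fun Y : 'M[F]_(r, k) => [ffun j => \row_a Y a j]).
  by move=> z; apply/ffunP => j; rewrite ffunE; apply/rowP => a; rewrite !mxE.
by move=> Y; apply/matrixP => a j; rewrite mxE ffunE mxE.
Qed.

(** With [v *m c = 1], adding [c *m u] to [Y] shifts [v *m Y] by [u], so [v *m Y] is uniform. *)
Lemma avg_fiber0 k (v : 'rV[F]_r) : v != 0 ->
  avg (fun Y : 'M[F]_(r, k) => (v *m Y == 0)%:R : R) = q ^- k.
Proof.
move=> /rV0Pn[a va].
pose c : 'cV[F]_r := (v 0 a)^-1 *: delta_mx a 0.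
have vc : v *m c = 1.
  rewrite -scalemxAr -colE; apply/matrixP => i j; rewrite !mxE !ord1 eqxx.
  by rewrite mulVf.
have F0 : (0 < #|{: 'rV[F]_k}|)%N by apply/card_gt0P; exists 0.
transitivity (avg (fun u : 'rV[F]_k =>
    avg (fun Y : 'M[F]_(r, k) => (v *m Y + u == 0)%:R : R))).
  rewrite -[LHS](avg_cst (T := 'rV[F]_k))//; apply: eq_avg => u.
  have bs : bijective (fun Y : 'M[F]_(r, k) => Y + c *m u).
    by exists (fun Y => Y - c *m u) => Y; rewrite ?addrK ?subrK.
  rewrite -(avg_bij _ bs); apply: eq_avg => Y /=.
  by rewrite mulmxDr mulmxA vc mul1mx.
rewrite exchange_avg -[RHS](avg_cst (T := 'M[F]_(r, k))); last first.
  by apply/card_gt0P; exists 0.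
apply: eq_avg => Y; rewrite /avg card_mx mul1n natrX (bigD1 (- (v *m Y)))//=.
rewrite subrr eqxx big1 ?addr0 ?mul1r// => u uv.
by rewrite addrC addr_eq0 (negPf uv).
Qed.

(** A union bound over the non-zero vectors that could lie in the left kernel. *)
Lemma avg_not_row_free k :
  avg (fun Y : 'M[F]_(r, k) => (~~ row_free Y)%:R : R) <= q ^+ r * q ^- k.
Proof.
have q0 : 0 <= q ^- k by rewrite invr_ge0 exprn_ge0.
apply: (@le_trans _ _ (avg (fun Y : 'M[F]_(r, k) =>
    \sum_(v : 'rV[F]_r | v != 0) (v *m Y == 0)%:R))).
  apply: ler_avg => Y; have [_|nfY] := boolP (row_free Y).
    by rewrite sumr_ge0.
  have [v vY v0] : exists2 v : 'rV_r, (v <= kermx Y)%MS & v != 0.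
    by apply/rowV0Pn; rewrite kermx_eq0.
  rewrite (bigD1 v)//= (sub_kermxP vY) eqxx lerDl.
  by rewrite sumr_ge0.
rewrite avg_sum; under eq_bigr => v v0 do rewrite avg_fiber0//.
rewrite sumr_const -[leLHS]mulr_natl ler_wpM2r// -natrX ler_nat.
by rewrite (leq_trans (max_card _))// card_mx mul1n.
Qed.

Context (m n : nat).
Hypotheses (rm : (r <= m)%N) (rn : (r <= n)%N).
Local Notation XY := ('M[F]_(r, m) * 'M[F]_(r, n))%type.

Let fiber (N : 'M[F]_(m, n)) := [set p : XY | p.1^T *m p.2 == N]%SET.

Let card_fiber_le (L : 'M[F]_m) (N : 'M[F]_(m, n)) (Q : 'M[F]_n) :
  L \in unitmx -> Q \in unitmx ->
  (#|fiber N| <= #|fiber (L *m N *m Q)|)%N.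
Proof.
move=> uL uQ; pose s (p : XY) : XY := (p.1 *m L^T, p.2 *m Q).
have s_inj : injective s.
  have uLT : L^T \in unitmx by rewrite unitmx_tr.
  move=> [X Y] [X' Y'] [/= E1 E2].
  by rewrite (can_inj (mulmxK uLT) E1) (can_inj (mulmxK uQ) E2).
rewrite -(card_imset _ s_inj); apply/subset_leq_card/fintype.subsetP => p.
move=> /imsetP[[X Y]]; rewrite !inE /= => /eqP <- ->.
by rewrite /= trmx_mul trmxK !mulmxA.
Qed.

(** A matrix of rank [r] is equivalent to [pid_mx r], and a change of bases carries factorizations
    to factorizations injectively in both directions. This is why the product conditioned on rank
    [r] is exactly uniform. *)
Let card_fiber_rank (N : 'M[F]_(m, n)) : \rank N = r ->
  #|fiber N| = #|fiber (pid_mx r)|.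
Proof.
move=> rN; have E := mulmx_ebase N; rewrite rN in E.
have uL := col_ebase_unit N; have uQ := row_ebase_unit N.
move: (col_ebase N) (row_ebase N) uL uQ E => L Q uL uQ <-.
apply/eqP; rewrite eqn_leq card_fiber_le// andbT.
have := @card_fiber_le (invmx L) (L *m pid_mx r *m Q) (invmx Q).
rewrite !unitmx_inv => /(_ uL uQ).
by rewrite !mulmxA mulVmx// mul1mx mulmxK.
Qed.

Let card_fiber_gt0 : (0 < #|fiber (pid_mx r)|)%N.
Proof.
apply/card_gt0P; exists (pid_mx r, pid_mx r); rewrite inE /= tr_pid_mx.
by rewrite mul_pid_mx minnn (minn_idPr (leqnn r)).
Qed.

Lemma avg_rank_prod_bad :
  avg (fun p : XY => (\rank (p.1^T *m p.2) != r)%:R : R) <=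
  q ^+ r * q ^- m + q ^+ r * q ^- n.
Proof.
apply: (@le_trans _ _ (avg (fun p : XY => (~~ row_free p.1)%:R + (~~ row_free p.2)%:R))).
  apply: ler_avg => -[X Y] /=.
  have [fX|_] := boolP (row_free X); last first.
    by rewrite (le_trans (y := 1))// ?lerDl//; case: (_ != _).
  have [fY|_] := boolP (row_free Y); last by rewrite add0r; case: (_ != _).
  by rewrite mxrankMfree// mxrank_tr (eqP fX) eqxx addr0.
rewrite avgD lerD//.
  rewrite (avg_pair (fun (X : 'M[F]_(r, m)) (_ : 'M[F]_(r, n)) => (~~ row_free X)%:R)).
  apply: le_trans (avg_not_row_free m); apply: ler_avg => X.
  by rewrite avg_cst//; apply/card_gt0P; exists 0.
rewrite (avg_pair (fun (_ : 'M[F]_(r, m)) (Y : 'M[F]_(r, n)) => (~~ row_free Y)%:R)).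
rewrite avg_cst ?avg_not_row_free//.
by apply/card_gt0P; exists 0.
Qed.

(** The average over products mixes the rank-[r] average [a] with values in [[0, 1]], the latter
    with weight [Tb / T], the probability of a rank defect. *)
Lemma avg_prod_rank (phi : 'M[F]_(m, n) -> R) : (forall N, 0 <= phi N <= 1) ->
  `|avg (fun p : XY => phi (p.1^T *m p.2)) -
    (\sum_(N | \rank N == r) phi N) / #|[pred N : 'M[F]_(m, n) | \rank N == r]|%:R|
  <= q ^+ r * q ^- m + q ^+ r * q ^- n.
Proof.
move=> phi01; apply: le_trans avg_rank_prod_bad.
set G := [pred N | _].
pose c : R := #|fiber (pid_mx r)|%:R.
have c0 : 0 < c by rewrite ltr0n.
have sumE (psi : 'M[F]_(m, n) -> R) : \sum_(p : XY | \rank (p.1^T *m p.2) == r)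
    psi (p.1^T *m p.2) = c * \sum_(N | \rank N == r) psi N.
  rewrite (partition_big (fun p : XY => p.1^T *m p.2) (fun N => \rank N == r))//=.
  rewrite mulr_sumr; apply: eq_bigr => N /eqP rN.
  rewrite (eq_bigr (fun=> psi N)); last by move=> p /andP[_ /eqP ->].
  rewrite sumr_const -[LHS]mulr_natl /c -(card_fiber_rank rN); congr (_%:R * _).
  apply: eq_card => p; rewrite inE unfold_in /=.
  by case: (p.1^T *m p.2 =P N) => [->|_]; rewrite ?andbF// rN eqxx.
have G0 : 0 < #|G|%:R :> R.
  rewrite ltr0n; apply/card_gt0P; exists (pid_mx r).
  by rewrite inE /= rank_pid_mx.
pose T : R := #|{: XY}|%:R.
have T0 : 0 < T by rewrite ltr0n; apply/card_gt0P; exists 0.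
set a := _ / #|G|%:R.
have sumG : \sum_(N | \rank N == r) phi N = a * #|G|%:R.
  by rewrite /a divfK// gt_eqF.
have a01 : 0 <= a <= 1.
  rewrite /a divr_ge0 ?ler0n ?sumr_ge0//=; last by move=> N _; case/andP: (phi01 N).
  rewrite ler_pdivrMr// mul1r -sum1_card natr_sum.
  by apply: ler_sum => N _; case/andP: (phi01 N).
pose bad := \sum_(p : XY | \rank (p.1^T *m p.2) != r) phi (p.1^T *m p.2).
pose Tb : R := \sum_(p : XY | \rank (p.1^T *m p.2) != r) 1.
have badTb : 0 <= bad <= Tb.
  rewrite sumr_ge0 /=; last by move=> p _; case/andP: (phi01 (p.1^T *m p.2)).
  by apply: ler_sum => p _; case/andP: (phi01 (p.1^T *m p.2)).
have TE : T = c * #|G|%:R + Tb.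
  rewrite /T -sum1_card natr_sum (bigID (fun p : XY => \rank (p.1^T *m p.2) == r)) /=.
  by rewrite (sumE (fun=> 1)) -(sum1_card G) natr_sum.
have -> : avg (fun p : XY => phi (p.1^T *m p.2)) = (c * (a * #|G|%:R) + bad) / T.
  rewrite /avg (bigID (fun p : XY => \rank (p.1^T *m p.2) == r)) /=.
  by rewrite (sumE phi) sumG.
have -> : avg (fun p : XY => (\rank (p.1^T *m p.2) != r)%:R : R) = Tb / T.
  rewrite /avg /Tb [in RHS]big_mkcond; congr (_ / _).
  by apply: eq_bigr => p _; case: (_ != _).
rewrite (_ : _ - a = (bad - Tb * a) / T); last first.
  by rewrite -[X in _ - X](mulfK (lt0r_neq0 T0)) -mulrBl TE; congr (_ / _); ring.
rewrite normrM normfV (gtr0_norm T0) ler_pM2r ?invr_gt0//.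
case/andP: a01 => a0 a1; case/andP: badTb => b0 b1.
have Tb0 := le_trans b0 b1.
by rewrite ler_norml; apply/andP; split; nra.
Qed.

Lemma avg_prod_mx (phi : 'M[F]_(m, n) -> R) :
  avg (fun wz => phi (@prod_mx F m n r wz.1 wz.2)) =
  avg (fun p : XY => phi (p.1^T *m p.2)).
Proof.
rewrite (avg_pair (fun w z => phi (@prod_mx F m n r w z))).
rewrite (avg_pair (fun (X : 'M[F]_(r, m)) (Y : 'M[F]_(r, n)) => phi (X^T *m Y))).
rewrite -(avg_bij _ (mx_of_cols_bij m)); apply: eq_avg => w /=.
rewrite -(avg_bij _ (mx_of_cols_bij n)); apply: eq_avg => z /=.
congr phi; apply/matrixP => i j; rewrite /prod_mx mxE [RHS]mxE /dot [LHS]mxE.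
by apply: eq_bigr => a _; rewrite !mxE.
Qed.

End RankTransfer.

(** * The cdf of the statistic under the uniform law *)

Lemma measure_seq d (T : measurableType d) (R : realType)
    (mu : {measure set T -> \bar R}) (E : eqType) (i : E -> T) (s : seq E) :
  injective i -> (forall B : set T, measurable B) -> uniq s ->
  mu [set i x | x in [set` s]] = (\sum_(x <- s) mu [set i x])%E.
Proof.
move=> iI mT; elim: s => [|x s IH] /=.
  by rewrite big_nil set_nil image_set0 measure0.
move=> /andP[xs us]; rewrite big_cons -IH// -measureU//.
  congr (mu _); rewrite -image_set1 -image_setU; congr (_ @` _).
  apply/seteqP; split => y /=; rewrite inE.
    by move=> /predU1P[->|ys]; [left|right].
  by move=> [->|ys]; rewrite ?eqxx// ys orbT.
rewrite -subset0 => _ [->] [y /= ys /iI yx].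
by rewrite yx in ys; rewrite ys in xs.
Qed.

Section UniformRank.
Context (R : realType) (F : finFieldType) (A : {set F}) (m n r : nat).
Context d (T : measurableType d) (P : probability T R).
Context (M : {RV P >-> dmatrix F m n}).

Lemma cdf_uniform_rank (x : R) : uniform_on (rank_matrices F m n r) M ->
  cdf (std_ct R A r \o M : {RV P >-> R}) x =
  ((\sum_(N : 'M[F]_(m, n) | \rank N == r) (std_ct R A r N <= x)%R%:R) /
    #|[pred N : 'M[F]_(m, n) | \rank N == r]|%:R)%:E.
Proof.
move=> Mu; pose s := [seq N <- enum {: dmatrix F m n} | std_ct R A r N <= x].
transitivity (distribution P M [set N | N in [set` s]]).
  rewrite /cdf /distribution /pushforward; congr (P _); apply/seteqP; split => t /=.
    rewrite in_itv /= => tx; exists (M t) => //.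
    by rewrite mem_filter tx mem_enum.
  by move=> [N]; rewrite mem_filter in_itv /= => /andP[Nx _] <-.
rewrite (@measure_seq _ _ _ (distribution P M) _ id)//; last first.
  by rewrite filter_uniq// enum_uniq.
rewrite big_filter big_enum_cond /=.
rewrite (eq_bigr (fun N : dmatrix F m n =>
  ((N \in rank_matrices F m n r)%:R / #|rank_matrices F m n r|%:R)%:E)); last first.
  by move=> N _; exact: Mu.
rewrite sumEFin -mulr_suml; congr (_ / _)%:E; last first.
  by congr (_%:R); apply: eq_card => N; rewrite !inE.
rewrite [LHS]big_mkcond [RHS]big_mkcond /=; apply: eq_bigr => N _.
by rewrite inE; case: (_ <= x); case: (_ == r).
Qed.

End UniformRank.

(** * Asymptotics along the sequence *)

Section Sequences.
Context (R : realType) (F : finFieldType) (A : {set F}).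
Context (m n r : nat -> nat).
Hypotheses (A_nonempty : A != finset.set0) (A_proper : A \proper finset.setT).
Hypotheses (m_gt0 : forall k, (0 < m k)%N) (n_gt0 : forall k, (0 < n k)%N).
Hypothesis r_gt0 : forall k, (0 < r k)%N.
Local Notation q := (#|F|%:R : R).
Local Notation p := (dens R A).
Local Notation rho k := (@qinv R F (r k)).

Let q2 : 2 <= q. Proof. by rewrite ler_nat card_finNzRing_gt1. Qed.
Let q0 : 0 < q. Proof. by rewrite (lt_le_trans _ q2). Qed.

Let dens_gt0 : 0 < p.
Proof. by rewrite mulr_gt0 ?invr_gt0// ltr0n card_gt0. Qed.

Let dens_lt1 : p < 1.
Proof.
rewrite /dens mulrC ltr_pdivrMr// mul1r ltr_nat -cardsT.
exact: proper_card.
Qed.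

(** [gamma] is [p - 1] or [p] according to whether 0 lies in [A], and [0 < p < 1]. *)
Let gamma_sqr_gt0 : 0 < gamma R A ^+ 2.
Proof.
rewrite exprn_even_gt0//= /gamma -/(dens R A).
by case: (0 \in A) => /=; [rewrite lt_eqF// subr_lt0|rewrite subr0 gt_eqF].
Qed.

Definition normal_approx : Prop := forall e : R, 0 < e ->
  \forall k \near \oo, forall K f f', stein_class K f f' ->
    `|avg (fun wz => f' (@std_prod R F A (m k) (n k) (r k) wz) -
        std_prod R A wz * f (std_prod R A wz))| <= K * e.

Let normal_approx_sqr :
  (forall eta : R, 0 < eta <= 1 ->
    \forall k \near \oo, forall K f f', stein_class K f f' ->
    `|avg (fun wz => f' (@std_prod R F A (m k) (n k) (r k) wz) -
        std_prod R A wz * f (std_prod R A wz))| <= K * (9 * eta)) ->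
  normal_approx.
Proof.
move=> H e e0; pose eta := Num.min 1 (e / 9).
have eta01 : 0 < eta <= 1 by rewrite lt_min ltr01 divr_gt0//= ge_min lexx.
apply: filterS (H _ eta01) => k Hk K f f' ff'.
apply: le_trans (Hk _ _ _ ff') _; rewrite ler_wpM2l ?(stein_class_ge0 ff')//.
have : eta <= e / 9 by rewrite ge_min lexx orbT.
lra.
Qed.

Lemma normal_approx_small_rank :
  (q ^+ r k / (minn (m k) (n k))%:R) @[k --> \oo] --> (0 : R) -> normal_approx.
Proof.
move=> cvg0; apply: normal_approx_sqr => eta eta01.
have /andP[eta0 eta1] := eta01.
pose C := 32 / (gamma R A ^+ 2 * eta ^+ 2).
have C0 : 0 < C by rewrite divr_gt0// mulr_gt0// exprn_gt0.
move/cvgrPdist_le : cvg0 => /(_ C^-1); rewrite invr_gt0 => /(_ C0).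
apply: filterS => k; rewrite sub0r normrN => hk K f f' ff'.
have qr0 : 0 < q ^+ r k by rewrite exprn_gt0.
have mn0 : 0 < (minn (m k) (n k))%:R :> R by rewrite ltr0n leq_min m_gt0 n_gt0.
have Cmn : C <= (minn (m k) (n k))%:R * rho k.
  move: hk; rewrite ger0_norm ?divr_ge0 ?(ltW qr0)// ler_pdivrMr//.
  by rewrite ler_pdivlMl// -ler_pdivlMr.
apply: (stein_edge_regime ff' eta01 (m_gt0 k) (n_gt0 k) (theta := C)).
- rewrite /qinv -(prednK (r_gt0 k)) exprS invfM mul1r.
  have h1 : q^-1 <= 2^-1 by rewrite lef_pV2 ?posrE.
  have h2 : (q ^+ (r k).-1)^-1 <= 1.
    by rewrite invf_le1 ?exprn_gt0// exprn_ege1// (le_trans _ q2)// ler1n.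
  rewrite -[leRHS]mulr1; apply: ler_pM h1 h2.
    by rewrite invr_ge0 ltW.
  by rewrite invr_ge0 exprn_ge0// ltW.
- by rewrite (le_trans Cmn)// ler_wpM2r ?(ltW (qinv_gt0 _ _ _))// ler_nat geq_minl.
- by rewrite (le_trans Cmn)// ler_wpM2r ?(ltW (qinv_gt0 _ _ _))// ler_nat geq_minr.
- by rewrite /C -mulrA divfK// gt_eqF// mulr_gt0// exprn_gt0.
Qed.

(** The growth hypothesis is the common consequence of conditions (ii) and (iii). [C] and [D] are
    solved from the two inequalities required by [stein_bulk_regime]. *)
Lemma normal_approx_large_rank :
  (forall C : R, \forall k \near \oo, C * ((m k)%:R + (n k)%:R) <= q ^+ r k) ->
  n k @[k --> \oo] --> \oo -> normal_approx.
Proof.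
move=> large n_oo; apply: normal_approx_sqr => eta eta01.
have /andP[eta0 eta1] := eta01.
have s0 : 0 < p * (1 - p) by rewrite mulr_gt0 ?subr_gt0.
have e20 : 0 < eta ^+ 2 by rewrite exprn_gt0.
pose C := 2 * (15 + q) / (p * (1 - p) * eta ^+ 2).
pose D := 256 / ((p * (1 - p)) ^+ 2 * eta ^+ 2).
have nD : \forall k \near \oo, D <= (n k)%:R.
  move/cvgnyPge : n_oo => /(_ (Num.bound D)); apply: filterS => k hk.
  apply: le_trans (ltW (archi_boundP _)) _; last by rewrite ler_nat.
  by rewrite divr_ge0// mulr_ge0 ?(ltW e20)// exprn_ge0// ltW.
near=> k; move=> K f f' ff'.
have qr0 : 0 < q ^+ r k by rewrite exprn_gt0.
have Ck : C * ((m k)%:R + (n k)%:R) <= q ^+ r k by near: k; exact: large.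
have Dk : D <= (n k)%:R by near: k.
apply: (stein_bulk_regime ff' eta01 (m_gt0 k) (n_gt0 k) s0).
  rewrite /qinv mulrA ler_pdivrMr// -(ler_pdivrMl _ _ (mulr_gt0 s0 e20)).
  by apply: le_trans Ck; rewrite /C mulrA [_ / _]mulrC.
by rewrite -mulrA -ler_pdivrMr// mulr_gt0 ?(exprn_gt0 _ s0).
Unshelve. all: by end_near. Qed.

Hypothesis r_le : forall k, (r k <= minn (m k) (n k))%N.
Hypothesis minBr_oo : (minn (m k) (n k) - r k)%N @[k --> \oo] --> \oo.

Let deficient k : R := q ^+ r k * q ^- m k + q ^+ r k * q ^- n k.

(** With [j = min(m, n) - r], each summand is at most [2 ^ - j]; since [2 ^ j >= j] and eventually
    [j >= 2 / e], it is at most [e / 2]. *)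
Let deficient_cvg0 : deficient k @[k --> \oo] --> (0 : R).
Proof.
apply/cvgrPdist_le => e e0.
move/cvgnyPge : minBr_oo => /(_ (Num.bound (2 / e))); apply: filterS => k hk.
set j := (_ - _)%N in hk.
have qj l : (j + r k <= l)%N -> q ^+ r k * q ^- l <= e / 2.
  move=> jl; have l_r : (r k <= l)%N by rewrite (leq_trans _ jl)// leq_addl.
  rewrite -(subnK l_r) exprD invfM mulrCA divff ?mulr1 ?expf_neq0 ?gt_eqF//.
  rewrite invf_ple ?posrE ?exprn_gt0 ?divr_gt0//.
  have -> : (e / 2)^-1 = 2 / e by rewrite invf_div.
  apply: le_trans (ltW (archi_boundP _)) _; first by rewrite divr_ge0// ltW.
  apply: (@le_trans _ _ (j%:R)); first by rewrite ler_nat.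
  apply: (@le_trans _ _ (2 ^+ (l - r k))); last by rewrite lerXn2r ?nnegrE ?(ltW q0).
  rewrite -natrX ler_nat (leq_trans (ltnW (ltn_expl j (isT : 1 < 2)%N)))//.
  by rewrite leq_exp2l// leq_subRL// addnC.
have jr : (j + r k = minn (m k) (n k))%N by rewrite /j subnK.
rewrite sub0r normrN ger0_norm ?addr_ge0 ?mulr_ge0 ?invr_ge0 ?exprn_ge0 ?(ltW q0)//.
by rewrite [e]splitr lerD// qj// jr ?geq_minl ?geq_minr.
Qed.

Context (d : nat -> measure_display) (T : forall k, measurableType (d k)).
Context (P : forall k, probability (T k) R).
Context (M : forall k, {RV (P k) >-> dmatrix F (m k) (n k)}).
Hypothesis M_unif : forall k, uniform_on (rank_matrices F (m k) (n k) (r k)) (M k).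

(** The cdf in question is the rank-[r] average [a k]. Stein's method gives the limit of the average
    [u k] over products, and [deficient k] bounds the gap. *)
Lemma normal_approx_cvg : normal_approx ->
  cvg_in_distribution (fun k => std_ct R A (r k) \o M k : {RV (P k) >-> R})
    (normal_prob 0 1).
Proof.
move=> approx x _.
suff lim : cdf (std_ct R A (r k) \o M k : {RV (P k) >-> R}) x @[k --> \oo] -->
    (normal_cdf x)%:E by rewrite normal_cdfE in lim.
pose Om k : finType := ({ffun 'I_(m k) -> 'rV[F]_(r k)} *
  {ffun 'I_(n k) -> 'rV[F]_(r k)})%type.
have Om0 k : (0 < #|Om k|)%N.
  by rewrite card_prod muln_gt0 !card_ffun_gt0 ?card_rV_gt0.
have := @stein_method R Om (fun k => @std_prod R F A (m k) (n k) (r k)) Om0 approx x.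
set u := fun k => avg _ => ucvg.
pose a k : R := (\sum_(N : 'M[F]_(m k, n k) | \rank N == r k)
  (std_ct R A (r k) N <= x)%R%:R) /
    #|[pred N : 'M[F]_(m k, n k) | \rank N == r k]|%:R.
under eq_fun => k do rewrite (cdf_uniform_rank A x (@M_unif k)).
apply: cvg_EFin; first by apply: nearW.
have ua k : `|u k - a k| <= deficient k.
  have rm : (r k <= m k)%N by rewrite (leq_trans (r_le k))// geq_minl.
  have rn : (r k <= n k)%N by rewrite (leq_trans (r_le k))// geq_minr.
  have := @avg_prod_rank R F (r k) (m k) (n k) rm rn
    (fun N => (std_ct R A (r k) N <= x)%R%:R).
  rewrite -(@avg_prod_mx R F (r k) (m k) (n k) (fun N => (std_ct R A (r k) N <= x)%R%:R)).
  apply => N.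
  by case: (_ <= x); rewrite /= ?lexx ler01.
have -> : fine \o (fun k => (a k)%:E) = fun k => u k - (u k - a k).
  by apply/funext => k /=; rewrite subKr.
rewrite -[X in _ --> X]subr0; apply: cvgB => //.
apply: norm_cvg0; apply: (@squeeze_cvgr _ _ _ _ (fun=> 0) deficient) => //.
- by apply: nearW => k; rewrite normr_ge0 ua.
- exact: cvg_cst.
Qed.

End Sequences.
Theorem theorem1 (R : realType) (F : finFieldType) (A : {set F})
    (A_nonempty : A != finset.set0) (A_proper : A \proper finset.setT)
    (m n r : nat -> nat)
    (m_gt0 : forall k, (0 < m k)%N) (n_gt0 : forall k, (0 < n k)%N)
    (r_gt0 : forall k, (0 < r k)%N)
    (r_le : forall k, (r k <= minn (m k) (n k))%N)
    (m_oo : m k @[k --> \oo] --> \oo) (n_oo : n k @[k --> \oo] --> \oo)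
    (minBr_oo : (minn (m k) (n k) - r k)%N @[k --> \oo] --> \oo)
    (cond :
      [\/ (#|F|%:R ^+ r k / (minn (m k) (n k))%:R : R) @[k --> \oo] --> (0 : R),
          (forall a : R, 0 < a ->
             (#|F|%:R ^+ r k / ((m k + n k)%:R `^ a) : R) @[k --> \oo]
               --> +oo%R)
        | asymp R m n /\
          (#|F|%:R ^+ r k / (m k)%:R : R) @[k --> \oo] --> +oo%R])
    (d : nat -> measure_display) (T : forall k, measurableType (d k))
    (P : forall k, probability (T k) R)
    (M : forall k, {RV (P k) >-> dmatrix F (m k) (n k)})
    (M_unif : forall k, uniform_on (rank_matrices F (m k) (n k) (r k)) (M k)) :
  cvg_in_distribution
    (fun k => std_ct R A (r k) \o M k : {RV (P k) >-> R})
    (normal_prob 0 1).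

Proof.
apply: (normal_approx_cvg r_le minBr_oo M_unif).
have large : (forall C : R, \forall k \near \oo,
    C * ((m k)%:R + (n k)%:R) <= #|F|%:R ^+ r k) -> normal_approx R A m n r.
  by move=> h; exact: (normal_approx_large_rank A_nonempty A_proper m_gt0 n_gt0 h n_oo).
case: cond => [small|superpoly|[[c [C [c0 _ mn]]] qm]].
- exact: (normal_approx_small_rank A_nonempty A_proper m_gt0 n_gt0 r_gt0 small).
(* Condition (ii) at the exponent [a = 1] already bounds [q ^ r / (m + n)] below by [C]
   eventually. *)
- apply: large => C; move/cvgryPge : (superpoly _ ltr01) => /(_ C).
  apply: filterS => k; rewrite powRr1// -natrD ler_pdivlMr//.
  by rewrite ltr0n addn_gt0 m_gt0.
(* From [c * n <= m] follows [m + n <= (1 + c^-1) * m]; [|D|] appears because [D] may be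
   negative. *)
- apply: large => D; move/cvgryPge : qm => /(_ (`|D| * (1 + c^-1))).
  apply: filterS => k; rewrite ler_pdivlMr ?ltr0n// => /(le_trans _); apply.
  apply: le_trans (ler_wpM2r _ (ler_norm D)) _; first by rewrite addr_ge0.
  rewrite -mulrA ler_wpM2l// mulrDl mul1r lerD2l ler_pdivlMl//.
  by case/andP: (mn k).
Qed.
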